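(* Let the mesh $\mathcal{T}_h$ be weakly acute and let $w_h\in\mathbb{V}_h$. If $L_h^\epsilon w_h(x_i)\ge0$ for all interior nodes $x_i\in\mathcal{N}_h$ and $w_h\le0$ on $\partial\Omega$, then $w_h\le0$ in $\Omega$.
   Context: $d\ge2$; $\Omega\subset\mathbb{R}^d$ is a bounded domain partitioned exactly by a conforming mesh $\mathcal{T}_h$ of simplices. $A:\Omega\to\mathbb{R}^{d\times d}$ is measurable with symmetric values and $\lambda I\le A(x)\le\Lambda I$ for a.e. $x$, $0<\lambda\le\Lambda$. $Q:=(\Lambda-\lambda/2)^{1/2}$, $\epsilon>0$. $\varphi\ge0$ is a fixed smooth radially symmetric function on $\mathbb{R}^d$ with compact support in the unit ball and $\int|y|^2\varphi(y)\,dy=d$. $\mathcal{N}_h$: interior nodes; $\mathbb{V}_h$: continuous functions on $\overline\Omega$ affine on each $K\in\mathcal{T}_h$; $\phi_i$: hat function of node $x_i$; $\omega_i=\operatorname{supp}\phi_i$. Weak acuteness: $k_{ij}:=\int_\Omega\nabla\phi_i\cdot\nabla\phi_j\le0$ for all nodes $x_i\ne x_j$ of $\mathcal{T}_h$ (boundary nodes included). Second differences: for $x$ with $\operatorname{dist}(x,\partial\Omega)>Q\epsilon$ put $\theta(x)=1$; for $x\in\Omega$ with $\operatorname{dist}(x,\partial\Omega)\le Q\epsilon$ let $\theta(x)\in(0,1]$ be the largest number such that $x\pm\theta y\in\Omega$ for all $y\in B_{Q\epsilon}(0)$. Set $\delta v(x,y):=\theta^{-2}[v(x+\theta y)+v(x-\theta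 y)-2v(x)]$, $\theta=\theta(x)$. Operators: $\bar A(x_i)=A(x_i)$ if $A$ is continuous, otherwise $\bar A(x_i)=|\omega_i|^{-1}\int_{\omega_i}A$; $M(x_i)=(\bar A(x_i)-\frac\lambda2I)^{1/2}$; $I_\epsilon v(x_i)=\int_{\mathbb{R}^d}\frac{\delta v(x_i,y)}{\epsilon^{d+2}\det M(x_i)}\varphi\big(\frac{M(x_i)^{-1}y}{\epsilon}\big)dy$; $\Delta_hv_h(x_i)=-(\int_\Omega\phi_i)^{-1}\int_\Omega\nabla v_h\cdot\nabla\phi_i$; $L_h^\epsilon v_h(x_i)=\frac\lambda2\Delta_hv_h(x_i)+I_\epsilon v_h(x_i)$ for $x_i\in\mathcal{N}_h$. *)

(* Defs.v *)
From HB Require Import structures.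
From mathcomp Require Import all_boot all_order all_algebra.
From mathcomp Require Import all_classical all_reals all_analysis.

Set Implicit Arguments.
Unset Strict Implicit.
Unset Printing Implicit Defensive.

Import Order.TTheory GRing.Theory Num.Theory.
Import numFieldNormedType.Exports.

Local Open Scope classical_set_scope.
Local Open Scope ring_scope.

(* Lebesgue measure on R^d is not in the library.  It is built as the d-fold
   product of the one-dimensional Lebesgue measure (on d.-tuples, Borel
   sigma-algebra), completed by the Caratheodory construction and transported to
   row vectors: measurable sets are the Lebesgue measurable sets and the measure
   is complete. *)
Section lebesgue_tuple.
Context (R : realType).
Local Notation T := (measurableTypeR R).

Definition tcons n (p : T * n.-tuple T) : n.+1.-tuple T :=
  [tuple of p.1 :: p.2].

Lemma measurable_tcons n : measurable_fun setT (@tcons n).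
Proof. exact: measurable_cons. Qed.

Section step.
Context (n : nat) (mu : {sigma_finite_measure set (n.-tuple T) -> \bar R}).

Definition leb_step (A : set (n.+1.-tuple T)) : \bar R :=
  (@lebesgue_measure R \x mu)%E (@tcons n @^-1` A).

Let mpre (A : set (n.+1.-tuple T)) :
  measurable A -> measurable (@tcons n @^-1` A).
Proof.
by move=> mA; rewrite -[X in measurable X]setTI; exact: measurable_tcons.
Qed.

Let leb_step0 : leb_step set0 = 0%E.
Proof. by rewrite /leb_step preimage_set0 measure0. Qed.

Let leb_step_ge0 A : (0 <= leb_step A)%E.
Proof. exact: measure_ge0. Qed.

Let leb_step_sigma_additive : semi_sigma_additive leb_step.
Proof.
move=> F mF tF mUF; rewrite /leb_step preimage_bigcup.
apply: measure_semi_sigma_additive.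
- by move=> i; exact: mpre.
- apply/trivIsetP => /= i j _ _ ij; rewrite -preimage_setI.
  by move/trivIsetP : tF => /(_ _ _ _ _ ij) ->//; rewrite preimage_set0.
- by rewrite -preimage_bigcup; exact: mpre.
Qed.

HB.instance Definition _ := isMeasure.Build _ _ _ leb_step
  leb_step0 leb_step_ge0 leb_step_sigma_additive.

Let leb_step_sigma_finite : sigma_finite setT leb_step.
Proof.
have /sigma_finiteP[F [FT ndF Foo]] := sigma_finiteT (@lebesgue_measure R).
have /sigma_finiteP[G [GT ndG Goo]] := sigma_finiteT mu.
pose u (t : n.+1.-tuple T) : T * n.-tuple T := (thead t, [tuple of behead t]).
have uK : cancel (@tcons n) u.
  by move=> [x t]; rewrite /u theadE; congr (_, _); exact/val_inj.
have mu' : measurable_fun setT u.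
  apply/measurable_fun_pair => //; last exact: measurable_behead.
  exact: measurable_tnth.
exists (fun k => u @^-1` (F k `*` G k)).
  rewrite -preimage_bigcup -(preimage_setT u); congr (u @^-1` _).
  rewrite -setXTT FT GT; apply/seteqP; split => [[x y]|[x y] [k _ [/= Fx Gy]]].
    move=> [/= [i _ Fx] [j _ Gy]]; exists (maxn i j) => //; split => /=.
    - by move: x Fx; exact/subsetPset/ndF/leq_maxl.
    - by move: y Gy; exact/subsetPset/ndG/leq_maxr.
  by split; exists k.
move=> k; have [mF Fk] := Foo k; have [mG Gk] := Goo k; split.
  by rewrite -[X in measurable X]setTI; apply: mu' => //; exact: measurableX.
rewrite /leb_step -comp_preimage (_ : u \o @tcons n = id); last first.
  by apply/funext => x; exact: uK.
by rewrite preimage_id product_measure1E// lte_mul_pinfty// ge0_fin_numE.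
Qed.

HB.instance Definition _ := Measure_isSigmaFinite.Build _ _ _ leb_step
  leb_step_sigma_finite.

End step.

Fixpoint leb_tuple n : {sigma_finite_measure set (n.-tuple T) -> \bar R} :=
  if n is n'.+1 then leb_step (leb_tuple n') else \d_[tuple].

End lebesgue_tuple.

Section lebesgue_vector.
Context (R : realType) (d : nat).

Definition leb_outer (A : set 'rV[R]_d) : \bar R :=
  mu_ext (@leb_tuple R d) [set t | A (\row_i tnth t i)].

Let leb_outer0 : leb_outer set0 = 0%E.
Proof. exact: outer_measure0. Qed.

Let leb_outer_ge0 A : (0 <= leb_outer A)%E.
Proof. exact: outer_measure_ge0. Qed.

Let le_leb_outer : {homo leb_outer : A B / A `<=` B >-> (A <= B)%E}.
Proof. by move=> A B AB; apply: le_outer_measure => t; exact: AB. Qed.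

Let leb_outer_sigma_subadditive : sigma_subadditive leb_outer.
Proof.
move=> F; rewrite /leb_outer.
exact: (outer_measure_sigma_subadditive (mu_ext (@leb_tuple R d))
  (fun k => [set t | F k (\row_i tnth t i)])).
Qed.

HB.instance Definition _ := isOuterMeasure.Build R 'rV[R]_d leb_outer
  leb_outer0 leb_outer_ge0 le_leb_outer leb_outer_sigma_subadditive.

(* 'rV[R]_d with the sigma-algebra of Lebesgue measurable sets. *)
Definition lebT := caratheodory_type leb_outer.
HB.instance Definition _ := Measurable.on lebT.

Definition leb : set lebT -> \bar R := leb_outer.

Let leb0 : leb set0 = 0%E.
Proof. exact: outer_measure0. Qed.

Let leb_ge0 A : (0 <= leb A)%E.
Proof. exact: outer_measure_ge0. Qed.

Let leb_sigma_additive : semi_sigma_additive leb.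
Proof. exact: (@caratheodory_measure_sigma_additive _ _ leb_outer). Qed.

HB.instance Definition _ := isMeasure.Build _ _ _ leb
  leb0 leb_ge0 leb_sigma_additive.

Lemma leb_is_complete : measure_is_complete leb.
Proof. exact: measure_is_complete_caratheodory. Qed.

End lebesgue_vector.

Lemma leb_tuple_box (R : realType) n (a b : 'I_n -> R) :
  (forall i, a i <= b i) ->
  let B := [set t : n.-tuple (measurableTypeR R) |
             forall i, a i <= tnth t i <= b i] in
  measurable B /\ leb_tuple R n B = (\prod_i (b i - a i))%:E.
Proof.
elim: n a b => [|n IH] a b ab B.
  have -> : B = setT by apply/seteqP; split => // t _ [].
  by split; [exact: measurableT|rewrite big_ord0 /= diracT].
pose a' i := a (lift ord0 i); pose b' i := b (lift ord0 i).
have [|mB' B'E] := IH a' b'; first by move=> i; exact: ab.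
set B' := [set t | _] in mB' B'E.
have mB : measurable B.
  have -> : B = \bigcap_(i in [set: 'I_n.+1])
      ((@tnth n.+1 (measurableTypeR R))^~ i @^-1` `[a i, b i]%classic).
    apply/seteqP; split => t /= H i; first by move=> _ /=; rewrite in_itv/=.
    by have := H i I; rewrite /= in_itv.
  apply: fin_bigcap_measurable => // i _.
  rewrite -[X in measurable X]setTI.
  by apply: (@measurable_tnth _ (measurableTypeR R) n.+1 i) => //;
    exact: measurable_itv.
split=> //=; rewrite /leb_step.
have -> : @tcons R n @^-1` B = `[a ord0, b ord0]%classic `*` B'.
  apply/seteqP; split => [[x t] H|[x t] [/= x0 tB] i].
    split => [|i]; first by have /= := H ord0; rewrite in_itv.
    by have /= := H (lift ord0 i); rewrite tnthS.
  case: (unliftP ord0 i) => [j ->|->]; first by rewrite /= tnthS; exact: tB.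
  by move: x0; rewrite in_itv.
have mI : measurable (`[a ord0, b ord0]%classic : set (measurableTypeR R)).
  exact: measurable_itv.
have IE : lebesgue_measure (`[a ord0, b ord0]%classic : set R) =
    (b ord0 - a ord0)%:E.
  rewrite lebesgue_measure_itv/= lte_fin.
  by case: ltgtP (ab ord0) => // <- _; rewrite subrr.
by rewrite product_measure1E//= B'E big_ord_recl EFinM -IE.
Qed.

(* Normalization of the measure: boxes have their usual volume. *)
Lemma leb_box (R : realType) d (a b : 'I_d -> R) : (forall i, a i <= b i) ->
  leb [set x : 'rV[R]_d | forall i, a i <= x 0 i <= b i] =
  (\prod_i (b i - a i))%:E.
Proof.
move=> /leb_tuple_box[mB <-]; rewrite -(measurable_mu_extE (leb_tuple R d) mB).
rewrite /leb /leb_outer; congr (mu_ext _ _).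
by apply/seteqP; split => t /= H i; have := H i; rewrite mxE.
Qed.

Section euclidean.
Context (R : realType) (d : nat).
Implicit Types (x y xi : 'rV[R]_d) (A B M S : 'M[R]_d) (Omega : set 'rV[R]_d).

(* The library norm `|x| on 'rV_d is the sup norm, hence [enorm]. *)
Definition dotv x y : R := \sum_i x 0 i * y 0 i.
Definition enorm x : R := Num.sqrt (dotv x x).

Definition integral_vec (D : set 'rV[R]_d) (f : 'rV[R]_d -> R) : R :=
  \int[@leb R d]_(x in D) f x.

Definition grad (v : 'rV[R]_d -> R) x : 'rV[R]_d :=
  \row_i 'D_(delta_mx 0 i) v x.

Fixpoint Cn (n : nat) (f : 'rV[R]_d -> R) : Prop :=
  continuous f /\
  if n is n'.+1 then
    forall i : 'I_d, (forall x, derivable f x (delta_mx 0 i)) /\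
      Cn n' (fun x => 'D_(delta_mx 0 i) f x)
  else True.

Definition smooth (f : 'rV[R]_d -> R) : Prop := forall n, Cn n f.

Definition supp (f : 'rV[R]_d -> R) : set 'rV[R]_d :=
  closure [set x | f x != 0].

Definition boundary Omega : set 'rV[R]_d := closure Omega `\` Omega°.

Definition dist_boundary Omega x : R :=
  inf [set enorm (x - z) | z in boundary Omega].

Definition bounded_domain Omega : Prop :=
  [/\ open Omega, connected Omega, Omega !=set0 & bounded_set Omega].

Definition qform A xi : R := (xi *m A *m xi^T) 0 0.
(* The order A <= B on symmetric matrices. *)
Definition loewner_le A B : Prop := forall xi, qform A xi <= qform B xi.

(* The positive semidefinite square root; it is unique when it exists, and the
   value 0 is a dummy for matrices that have none. *)
Definition sqrtmx S : 'M[R]_d :=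
  xget 0 [set M | [/\ M^T = M, forall xi, 0 <= qform M xi & M *m M = S]].

Definition kernel_ok (phi : 'rV[R]_d -> R) : Prop :=
  [/\ forall y, 0 <= phi y,
      smooth phi,
      forall x y, enorm x = enorm y -> phi x = phi y,
      compact (supp phi) /\ supp phi `<=` [set y | enorm y <= 1] &
      integral_vec setT (fun y => enorm y ^+ 2 * phi y) = d%:R].

End euclidean.

Section mesh.
Context (R : realType) (d : nat).

(* A simplex is given by the set of (indices of) its vertices. *)
Record mesh := Mesh {
  nb_nodes : nat;
  node : 'I_nb_nodes -> 'rV[R]_d;
  cells : {set {set 'I_nb_nodes}} }.

Variables (Omega : set 'rV[R]_d) (Th : mesh).
Local Notation nodeT := 'I_(nb_nodes Th).
Implicit Types (K : {set nodeT}) (i j : nodeT) (v w : 'rV[R]_d -> R).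

Definition simplex K : set 'rV[R]_d :=
  [set p | exists t : nodeT -> R,
    [/\ forall j, 0 <= t j, \sum_(j in K) t j = 1 &
        p = \sum_(j in K) t j *: node j]].

Definition affinely_independent K : Prop :=
  forall t : nodeT -> R,
    \sum_(j in K) t j = 0 -> \sum_(j in K) t j *: node j = 0 ->
    forall j, j \in K -> t j = 0.

Record conforming_mesh : Prop := ConformingMesh {
  mesh_node_inj : injective (@node Th);
  mesh_node_cell : forall i, exists2 K, K \in cells Th & i \in K;
  mesh_cell_card : forall K, K \in cells Th -> #|K| = d.+1;
  mesh_cell_indep : forall K, K \in cells Th -> affinely_independent K;
  (* two simplices meet in a common face, possibly empty *)
  mesh_conforming : forall K K', K \in cells Th -> K' \in cells Th ->
    simplex K `&` simplex K' = simplex (K :&: K');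
  mesh_cover : closure Omega = \bigcup_(K in [set` cells Th]) simplex K;
  mesh_interior : forall K, K \in cells Th -> (simplex K)° `<=` Omega }.

Definition interior_node i : Prop := Omega (node i).

(* Functions on closure Omega are represented by total functions; the values
   outside closure Omega are irrelevant. *)
Definition Vh v : Prop :=
  {within closure Omega, continuous v} /\
  forall K, K \in cells Th -> exists (a : 'rV[R]_d) (b : R),
    forall p, simplex K p -> v p = dotv a p + b.

(* The unique element of Vh with nodal values delta_ij, extended by 0 outside
   closure Omega; the default value of xget is a dummy. *)
Definition hat i : 'rV[R]_d -> R :=
  xget (fun=> 0) [set v | [/\ Vh v, forall j, v (node j) = (i == j)%:R &
                              forall p, ~ closure Omega p -> v p = 0]].

Definition omega i : set 'rV[R]_d := supp (hat i).

Definition stiffness i j : R :=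
  integral_vec Omega (fun x => dotv (grad (hat i) x) (grad (hat j) x)).

Definition weakly_acute : Prop := forall i j, i != j -> stiffness i j <= 0.

Definition laplace_h v i : R :=
  - (integral_vec Omega (hat i))^-1 *
    integral_vec Omega (fun x => dotv (grad v x) (grad (hat i) x)).

(* Used with r = Q * eps.  As Omega and the ball of radius r are open, the supremum
   is attained when x is in Omega. *)
Definition theta (r : R) (x : 'rV[R]_d) : R :=
  if r < dist_boundary Omega x then 1
  else sup [set t | 0 < t <= 1 /\
         forall y, enorm y < r -> Omega (x + t *: y) /\ Omega (x - t *: y)].

Definition second_diff (r : R) v (x y : 'rV[R]_d) : R :=
  (theta r x) ^- 2 *
    (v (x + theta r x *: y) + v (x - theta r x *: y) - 2 * v x).

Variables (A : 'rV[R]_d -> 'M[R]_d) (lambda Lambda eps : R).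
Variable phi : 'rV[R]_d -> R.

Definition Abar i : 'M[R]_d :=
  if `[< {within Omega, continuous A} >] then A (node i)
  else \matrix_(k, l) ((fine (@leb R d (omega i)))^-1 *
                       integral_vec (omega i) (fun x => A x k l)).

Definition Qconst : R := Num.sqrt (Lambda - lambda / 2).

Definition Mmx i : 'M[R]_d := sqrtmx (Abar i - (lambda / 2)%:M).

(* Vectors are rows: M^{-1} y is written y *m M^{-1}, M being symmetric. *)
Definition I_eps v i : R :=
  integral_vec setT (fun y =>
    second_diff (Qconst * eps) v (node i) y / (eps ^+ (d + 2) * \det (Mmx i)) *
    phi (eps^-1 *: (y *m invmx (Mmx i)))).

Definition L_eps_h v i : R := lambda / 2 * laplace_h v i + I_eps v i.

Definition coefficient_ok : Prop :=
  [/\ forall k l, measurable_fun (Omega : set (lebT R d))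
        (fun x : lebT R d => A x k l),
      forall x, Omega x -> (A x)^T = A x &
      {ae @leb R d, forall x, Omega x ->
        loewner_le lambda%:M (A x) /\ loewner_le (A x) Lambda%:M}].

End mesh.

(* Main.v *)
(* Let [m] be the maximum of [w] over the nodes, attained at the set [S] of
   nodes, and suppose [m > 0], so that [S] consists of interior nodes.  As the
   kernel is supported where [|y| <= Q eps], the nonlocal term is nonpositive at
   the nodes of [S], so the discrete Laplacian is nonnegative there.  This says
   [\sum_j k_ij (w_j - m) <= 0]; all terms being nonnegative, [k_ij = 0] for [i]
   in [S] and [j] not in [S].  Then [\sum_(i in S) hat i] has zero Dirichlet
   energy, so each simplex has either all its vertices in [S] or none.  By
   connectedness [w = m] up to the boundary, a contradiction. *)
Require Import Defs.
From HB Require Import structures.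
From mathcomp Require Import all_boot all_order all_algebra.
From mathcomp Require Import all_classical all_reals all_analysis.
From mathcomp Require Import polyrcf measurable_realfun ring lra.

Set Implicit Arguments.
Unset Strict Implicit.
Unset Printing Implicit Defensive.

Import Order.TTheory GRing.Theory Num.Theory.
Import numFieldNormedType.Exports.

Local Open Scope classical_set_scope.
Local Open Scope ring_scope.


(** * Half-spaces and hyperplanes *)

(** Weak acuteness allows [k_ij = 0] along a mesh edge, so the maximum cannot be passed from node to
    neighbour one edge at a time; the energy of the whole set [S] replaces that walk, and it is a
    sum of squared gradients times positive volumes, so nothing cancels between cells. The constant
    [Q] is tuned to the support of the kernel: where [phi] does not vanish, [y = z M] with
    [|z| <= eps], and [|z M|^2 = z M^2 z^T <= (Lambda - lambda/2) |z|^2]. This requires the upper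
    bound on [Abar] at the node itself, while [A] is bounded only almost everywhere. That support is
    a closed ball whereas [theta] is defined through the open one, so shifted points are only known
    to lie in [closure Omega]; this suffices, because the maximum over the nodes bounds [w]
    there. *)

Section lebesgue.
Context (R : realType).
Local Notation T := (measurableTypeR R).

(** Induction on the dimension through the product construction. If a later coefficient is nonzero,
    every slice is a hyperplane one dimension lower; otherwise the set is a point times the full
    space. *)
Lemma leb_tuple_hyperplane n (a : 'I_n -> R) (c : R) (i : 'I_n) :
  a i != 0 -> leb_tuple R n [set t | \sum_i a i * tnth t i = c] = 0%E.
Proof.
elim: n a c i => [|n IH] a c i ai0; first by case: i ai0.
rewrite /= /leb_step.
have sumE (p : T * n.-tuple T) : \sum_(j < n.+1) a j * tnth (tcons p) j =
    a ord0 * p.1 + \sum_j a (lift ord0 j) * tnth p.2 j.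
  by rewrite big_ord_recl; congr (_ + _); apply: eq_bigr => j _; rewrite tnthS.
set H := (X in (_ \x _)%E X).
have HE : H = [set p : T * n.-tuple T |
    a ord0 * p.1 + \sum_j a (lift ord0 j) * tnth p.2 j = c].
  by apply/seteqP; split => p; rewrite /H /= sumE.
have [[j aj]|a'0] := pselect (exists j, a (lift ord0 j) != 0).
  rewrite /product_measure1 integral0_eq// => x _ /=.
  rewrite (_ : xsection _ _ = [set t : n.-tuple T |
     \sum_j a (lift ord0 j) * tnth t j = c - a ord0 * x]); first exact: IH aj.
  rewrite HE; apply/seteqP; split => t; rewrite /xsection /= in_setE /=.
    by move=> <-; ring.
  by move=> ->; ring.
have a'E j : a (lift ord0 j) = 0.
  by apply/eqP; apply: contra_notT a'0 => aj; exists j.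
have a0 : a ord0 != 0 by case: (unliftP ord0 i) ai0 => [j ->|->//];
  rewrite a'E eqxx.
have -> : H = [set c / a ord0] `*` setT.
  rewrite HE; apply/seteqP; split => -[x t] /=; rewrite big1 ?addr0.
  - by move=> <-; split => //; field.
  - by move=> j _; rewrite a'E mul0r.
  - by move=> [-> _]; field.
  - by move=> j _; rewrite a'E mul0r.
rewrite product_measure1E//.
by rewrite [X in (X * _)%E](_ : _ = 0%E) ?mul0e//; exact: lebesgue_measure_set1.
Qed.

Context (d : nat).
Local Notation V := 'rV[R]_d.
Local Notation L := (lebT R d).

(** [leb_outer] is the outer measure extending [leb_tuple], read through rows, and Borel sets of
    tuples satisfy Caratheodory's criterion for that extension. *)
Lemma leb_measurable (A : set V) :
  measurable [set t : d.-tuple T | A (\row_i tnth t i)] ->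
  measurable (A : set L).
Proof.
move=> mA.
suff cA : (mu_ext (leb_tuple R d)).-cara.-measurable
    [set t : d.-tuple T | A (\row_i tnth t i)].
  suff h : caratheodory_measurable (@leb_outer R d) A by exact: h.
  by move=> X; exact: cA [set t | X (\row_i tnth t i)].
by apply: sub_caratheodory; exact: sub_sigma_algebra.
Qed.

Lemma lebE (A : set V) :
  measurable [set t : d.-tuple T | A (\row_i tnth t i)] ->
  leb A = leb_tuple R d [set t | A (\row_i tnth t i)].
Proof. by move=> mA; rewrite -(measurable_mu_extE (leb_tuple R d) mA). Qed.

Let dotE (a : V) (t : d.-tuple T) :
  dotv a (\row_i tnth t i) = \sum_i a 0 i * tnth t i.
Proof. by apply: eq_bigr => i _; rewrite mxE. Qed.

Let measurable_dot (a : V) : measurable_fun setT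
  (fun t : d.-tuple T => dotv a (\row_i tnth t i) : T).
Proof.
under eq_fun do rewrite dotE.
apply: measurable_sum => i; apply: measurable_funM => //.
exact: measurable_tnth.
Qed.

Lemma measurable_affine (a : V) (b : R) :
  measurable_fun setT (fun x : L => dotv a x + b : T).
Proof.
move=> _ Y mY; rewrite setTI; apply: leb_measurable.
have mf := measurable_funD (measurable_dot a) (@measurable_cst _ _ _ T setT b).
have := mf measurableT Y mY; rewrite setTI.
exact.
Qed.

Lemma leb_hyperplane (a : V) (b : R) : a != 0 ->
  leb [set x : V | dotv a x + b = 0] = 0%E.
Proof.
move=> a0.
have [i ai] : exists i, a 0 i != 0.
  apply: contra_neqP a0 => /forallNP a0; apply/rowP => i; rewrite mxE.
  by apply/eqP; apply: contra_notT (a0 i) => ->.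
rewrite lebE.
  rewrite -(@leb_tuple_hyperplane d (a 0) (- b) i ai); congr (leb_tuple _ _ _).
  by apply/seteqP; split => t /=; rewrite dotE =>
    /eqP; [rewrite addr_eq0 => /eqP | rewrite -addr_eq0 => /eqP].
have mf := measurable_funD (measurable_dot a) (@measurable_cst _ _ _ T setT b).
have := mf measurableT [set 0] (measurable_set1 _); rewrite setTI.
exact.
Qed.

Lemma measurable_halfspace (a : V) (b : R) :
  measurable ([set x | 0 < dotv a x + b] : set L).
Proof.
have := measurable_affine a b measurableT (measurable_itv `]0, +oo[).
by rewrite setTI; congr measurable; apply/seteqP; split => x /=;
  rewrite in_itv/= andbT.
Qed.

End lebesgue.

(** * Cubes, and positive measure of neighbourhoods *)

Section boxes.
Context (R : realType) (d : nat).
Local Notation V := 'rV[R]_d.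
Local Notation L := (lebT R d).

Definition cube (x : V) (r : R) : set V :=
  [set y | forall i, x 0 i - r <= y 0 i <= x 0 i + r].

Lemma measurable_cube x r : 0 <= r -> measurable (cube x r : set L).
Proof.
move=> r0; apply: leb_measurable.
have [|mB _] := @leb_tuple_box R d (fun i => x 0 i - r) (fun i => x 0 i + r).
  by move=> i; lra.
congr measurable: mB; apply/seteqP.
by split => t /= H i; have := H i; rewrite mxE.
Qed.

Lemma leb_cube x r : 0 <= r -> leb (cube x r) = ((2 * r) ^+ d)%:E.
Proof.
move=> r0; rewrite leb_box; last by move=> i; lra.
rewrite (eq_bigr (fun=> 2 * r)); last by move=> i _; ring.
by rewrite prodr_const card_ord.
Qed.

Lemma nbhs_cube (x : V) (U : set V) : nbhs x U ->
  exists2 r, 0 < r & cube x r `<=` U.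
Proof.
move=> /nbhs_ballP[e /= e0 eU]; exists (e / 2); first by rewrite divr_gt0.
move=> y xy; apply: eU; split => // i j; rewrite (ord1 i) /ball /=.
by have := xy j; rewrite ltr_distlC => ?; lra.
Qed.

(** Source of strict positivity later on: cell volumes, masses of hat functions, and the fact that a
    null set contains no neighbourhood. *)
Lemma leb_nbhs_gt0 (x : V) (U : set V) : nbhs x U -> measurable (U : set L) ->
  (0 < leb U)%E.
Proof.
move=> /nbhs_cube[r r0 xU] mU.
apply: (@lt_le_trans _ _ (leb (cube x r))).
  by rewrite leb_cube ?ltW// lte_fin exprn_gt0// mulr_gt0.
by apply: le_measure => //; rewrite inE//; apply: measurable_cube; exact: ltW.
Qed.

Lemma bounded_cube (U : set V) : bounded_set U -> exists2 r,
  0 < r & U `<=` cube 0 r.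
Proof.
move=> [r [_ Ur]]; exists (`|r| + 1); first by rewrite ltr_wpDl.
move=> x Ux i; rewrite mxE.
have : `|x 0 i| <= `|r| + 1.
  apply: le_trans (_ : `|x| <= _).
    by rewrite [leRHS]mx_normrE; apply: (le_bigmax _ (fun i =>
      `|x i.1 i.2|) (0, i)).
  by apply: (Ur _ _ _ Ux); rewrite ltr_pwDr// ler_norm.
by rewrite ler_norml; lra.
Qed.

End boxes.

(** * Quadratic forms *)

Section quadratic_forms.
Context (R : realType) (d : nat).
Implicit Types (x y : 'rV[R]_d) (A M : 'M[R]_d).

Lemma dotvE x y : dotv x y = (x *m y^T) 0 0.
Proof. by rewrite mxE; apply: eq_bigr => i _; rewrite mxE. Qed.

Lemma dotvC x y : dotv x y = dotv y x.
Proof. by apply: eq_bigr => i _; rewrite mulrC. Qed.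

Lemma dotvDl x y z : dotv (x + y) z = dotv x z + dotv y z.
Proof. by rewrite !dotvE mulmxDl mxE. Qed.

Lemma dotvZl (a : R) x z : dotv (a *: x) z = a * dotv x z.
Proof. by rewrite !dotvE -scalemxAl mxE. Qed.

Lemma dotvDr x y z : dotv z (x + y) = dotv z x + dotv z y.
Proof. by rewrite dotvC dotvDl !(dotvC z). Qed.

Lemma dotvZr (a : R) x z : dotv z (a *: x) = a * dotv z x.
Proof. by rewrite dotvC dotvZl (dotvC z). Qed.

Lemma dotv_sumr (I : finType) (P : pred I) (F : I -> 'rV[R]_d) z :
  dotv z (\sum_(i | P i) F i) = \sum_(i | P i) dotv z (F i).
Proof.
rewrite dotvE raddf_sum mulmx_sumr summxE.
by apply: eq_bigr => i _; rewrite dotvE.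
Qed.

Lemma dotv_suml (I : finType) (P : pred I) (F : I -> 'rV[R]_d) z :
  dotv (\sum_(i | P i) F i) z = \sum_(i | P i) dotv (F i) z.
Proof. by rewrite dotvC dotv_sumr; apply: eq_bigr => i _; rewrite dotvC. Qed.

Lemma dotvv_ge0 x : 0 <= dotv x x.
Proof. by apply: sumr_ge0 => i _; rewrite -expr2 sqr_ge0. Qed.

Lemma dotvv_eq0 x : (dotv x x == 0) = (x == 0).
Proof.
apply/idP/eqP => [|->]; last by rewrite dotvE mul0mx mxE.
rewrite psumr_eq0 => [/allP x0|i _]; last by rewrite -expr2 sqr_ge0.
apply/rowP => i; rewrite mxE; apply/eqP.
by have := x0 i (mem_index_enum _); rewrite mulf_eq0 orbb.
Qed.

Lemma enorm_ge0 x : 0 <= enorm x.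
Proof. exact: sqrtr_ge0. Qed.

Lemma sqr_enorm x : enorm x ^+ 2 = dotv x x.
Proof. by rewrite sqr_sqrtr// dotvv_ge0. Qed.

Lemma enormZ (a : R) x : enorm (a *: x) = `|a| * enorm x.
Proof.
by rewrite /enorm dotvZl dotvZr mulrA -expr2 sqrtrM ?sqr_ge0// sqrtr_sqr.
Qed.

Lemma enormN x : enorm (- x) = enorm x.
Proof. by rewrite -scaleN1r enormZ normrN1 mul1r. Qed.

Lemma qform_scalar (a : R) x : qform a%:M x = a * dotv x x.
Proof. by rewrite /qform mul_mx_scalar -scalemxAl mxE dotvE. Qed.

Lemma qformB A M x : qform (A - M) x = qform A x - qform M x.
Proof. by rewrite /qform mulmxBr mulmxBl !mxE. Qed.

Lemma qformE A x : qform A x = \sum_k \sum_l x 0 k * x 0 l * A k l.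
Proof.
rewrite /qform mxE exchange_big; apply: eq_bigr => l _.
by rewrite !mxE mulr_suml; apply: eq_bigr => k _; rewrite mulrAC.
Qed.

(* The real eigenvalues of [M] are nonnegative, so the monic polynomial
   [t |-> \det (t + M)] has no positive root. *)
Lemma det_psd_ge0 M : (forall x, 0 <= qform M x) -> 0 <= \det M.
Proof.
move=> M0; pose p := char_poly (- M).
have p0 : p.[0] = \det M.
  by rewrite horner_coef0 char_poly_det -(scaleN1r M) detZ mulrA -exprD addnn
    -mul2n exprM sqrrN expr1n expr1n mul1r.
have noroot t : 0 < t -> ~~ root p t.
  move=> t0; rewrite -eigenvalue_root_char; apply/negP => /eigenvalueP[v vM v0].
  have := M0 v; rewrite /qform -[M]opprK mulmxN vM mulNmx -scalemxAl.
  rewrite [X in 0 <= X]mxE [X in 0 <= - X]mxE -dotvE.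
  have : 0 < dotv v v by rewrite lt0r dotvv_ge0 dotvv_eq0 v0.
  by move=> v1; rewrite oppr_ge0 leNgt mulr_gt0.
rewrite leNgt; apply/negP; rewrite -p0 => pneg.
have [|N N1] := @poly_pinfty_gt_lc R p.
  by rewrite (monicP (char_poly_monic _)).
have pN : 0 < p.[Num.max N 1].
  apply: lt_le_trans (N1 _ _); last by rewrite le_max lexx.
  by rewrite (monicP (char_poly_monic _)).
have [||t /andP[t0 _] rt] := @poly_ivt R p 0 (Num.max N 1).
- by rewrite le_max ler01 orbT.
- by rewrite (ltW pneg) (ltW pN).
have : t != 0 by apply: contraTneq rt => ->; rewrite /root lt_eqF.
by move=> tn0; have := noroot t; rewrite lt0r tn0 t0 rt => /(_ isT).
Qed.

(** Positivity on [e_k + e_l] and [e_k - e_l] gives [2 |A_kl| <= A_kk + A_ll], and diagonal entries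
    are at most [b]. This makes the entries of the coefficient bounded, hence integrable. *)
Lemma entry_bound A (a b : R) k l : A^T = A -> 0 <= a ->
  loewner_le a%:M A -> loewner_le A b%:M -> `|A k l| <= b.
Proof.
move=> AT a0 aA Ab.
have eE (i j : 'I_d) : dotv (delta_mx 0 i) (delta_mx 0 j) = (i == j)%:R :> R.
  rewrite /dotv (bigD1 i)//= big1 ?addr0 => [|h hi];
    rewrite !mxE ?eqxx ?mul1r//=.
  by rewrite (negPf hi) mul0r.
have AE (i j : 'I_d) : ((delta_mx 0 i : 'rV[R]_d) *m A *m (delta_mx 0 j :
  'rV[R]_d)^T) 0 0 = A i j.
  by rewrite trmx_delta -rowE -colE !mxE.
pose B (x y : 'rV[R]_d) := (x *m A *m y^T) 0 0.
have BDl x y z : B (x + y) z = B x z + B y z by rewrite /B !mulmxDl mxE.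
have BDr x y z : B z (x + y) = B z x + B z y.
  by rewrite /B linearD/= mulmxDr mxE.
have BN x z : B z (- x) = - B z x by rewrite /B linearN/= mulmxN mxE.
have Bsym x y : B y x = B x y.
  transitivity ((x *m A *m y^T)^T 0 0); last by rewrite mxE.
  by rewrite !trmx_mul trmxK AT mulmxA.
have q x y : qform A (x + y) = qform A x + qform A y + 2 * B x y.
  by rewrite /qform -!/(B _ _) BDl !BDr (Bsym x y); ring.
have psd x : 0 <= qform A x.
  by apply: le_trans (aA x); rewrite qform_scalar mulr_ge0 ?dotvv_ge0.
have qd i : qform A (delta_mx 0 i) <= b.
  by apply: (le_trans (Ab _)); rewrite qform_scalar eE eqxx mulr1.
have := qd k; have := qd l; have := psd (delta_mx 0 k + delta_mx 0 l).
have := psd (delta_mx 0 k - delta_mx 0 l).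
have qN x : qform A (- x) = qform A x.
  by rewrite /qform linearN/= mulNmx mulNmx mulmxN opprK.
rewrite !q qN BN /B !AE => h1 h2 h3 h4.
by rewrite ler_norml; apply/andP; split; lra.
Qed.

End quadratic_forms.

(** * Barycentric coordinates *)

(** With rows [(1, pt i)], affine independence becomes linear independence of [d + 1] rows in
    dimension [1 + d]; solving [u *m B = (1, p)] gives weights affine in [p]. *)
Lemma affine_coordinates (R : realType) (d n : nat) (pt : 'I_n -> 'rV[R]_d) :
  n = d.+1 ->
  (forall u : 'I_n -> R, \sum_i u i = 0 -> \sum_i u i *: pt i = 0 ->
     forall i, u i = 0) ->
  exists (a : 'I_n -> 'rV[R]_d) (b : 'I_n -> R), forall p,
    \sum_i (dotv (a i) p + b i) = 1 /\
    \sum_i (dotv (a i) p + b i) *: pt i = p.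
Proof.
move=> nd indep.
pose B : 'M[R]_(n, 1 + d) := \matrix_i row_mx 1%:M (pt i).
have uB (u : 'rV[R]_n) :
    u *m B = row_mx (\sum_i u 0 i)%:M (\sum_i u 0 i *: pt i).
  rewrite -[LHS]hsubmxK; congr row_mx; apply/rowP => k.
    rewrite ord1 !mxE eqxx mulr1n; apply: eq_bigr => i _.
    by rewrite mxE row_mxEl mxE eqxx mulr1.
  rewrite !mxE summxE; apply: eq_bigr => i _.
  by rewrite mxE row_mxEr mxE.
have Bfull : row_full B.
  have : row_free B.
    apply: inj_row_free => u; rewrite uB -[X in _ = X -> _]row_mx0.
    move=> /eq_row_mx[u0 un0]; apply/rowP => i; rewrite mxE.
    apply: indep un0 i.
    by have /matrixP/(_ 0 0) := u0; rewrite !mxE eqxx mulr1n.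
  by rewrite /row_free /row_full => /eqP ->; rewrite nd.
(* [B] is square only through the equation [n = d.+1], so the pseudo-inverse plays the role of the
   inverse. *)
pose P := pinvmx B.
pose a i : 'rV[R]_d := \row_k P (rshift 1 k) i.
pose b i : R := P (lshift d 0) i.
exists a, b => p.
have abE i : dotv (a i) p + b i = (row_mx 1%:M p *m P) 0 i.
  rewrite mxE big_split_ord/= big_ord1 addrC; congr (_ + _).
    by apply: eq_bigr => k _; rewrite row_mxEr mxE mulrC.
  by rewrite row_mxEl mxE eqxx mul1r.
have : row_mx 1%:M p *m P *m B = row_mx 1%:M p by rewrite mulmxKpV// submx_full.
rewrite uB => /eq_row_mx[/matrixP/(_ 0 0)]; rewrite !mxE eqxx !mulr1n => s1 sp.
split; first by rewrite -[RHS]s1; apply: eq_bigr => i _; rewrite abE.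
by rewrite -[RHS]sp; apply: eq_bigr => i _; rewrite abE.
Qed.

Section barycentric.
Context (R : realType) (d : nat) (Th : mesh R d).
Local Notation V := 'rV[R]_d.
Local Notation nodeT := 'I_(nb_nodes Th).
Local Notation node := (@node R d Th).
Implicit Types (K : {set nodeT}) (i j : nodeT) (p : V).

(** [c.1 j] is the constant gradient and [c.2 j] the constant term of the coordinate of node [j].
    Forcing both to vanish off [K] lets sums range over all nodes. *)
Definition is_bary K (c : (nodeT -> V) * (nodeT -> R)) : Prop :=
  [/\ forall j, j \notin K -> c.1 j = 0 /\ c.2 j = 0,
      forall p, \sum_(j in K) (dotv (c.1 j) p + c.2 j) = 1 &
      forall p, \sum_(j in K) (dotv (c.1 j) p + c.2 j) *: node j = p].

Definition bary K := xget (fun=> 0, fun=> 0) (is_bary K).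

(* The barycentric coordinate of node [j] in the simplex [K], set to 0 when
   [j] is not a vertex of [K]. *)
Definition lam K j p := dotv ((bary K).1 j) p + (bary K).2 j.

(** For a nondegenerate simplex this is its interior; as a finite intersection of open half-spaces
    it is visibly open and measurable. *)
Definition open_simplex K : set V := [set p | forall j,
  j \in K -> 0 < lam K j p].

Variable K : {set nodeT}.
Hypothesis Kcard : #|K| = d.+1.
Hypothesis Kindep : affinely_independent K.

Lemma bary_exists : exists c, is_bary K c.
Proof.
have /card_gt0P/sigW[j0 Kj0] : (0 < #|K|)%N by rewrite Kcard.
have [|a [b abP]] := @affine_coordinates R d #|K| (fun i : 'I_#|K| =>
  node (enum_val i)) Kcard.
  move=> u u0 un0 i; pose t j := u (enum_rank_in Kj0 j).
  have tE (k : 'I_#|K|) : t (enum_val k) = u k by rewrite /t enum_valK_in.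
  rewrite -tE; apply: (Kindep (t := t)); last exact: enum_valP.
    by rewrite big_enum_val/= (eq_bigr u).
  by rewrite big_enum_val/= (eq_bigr (fun k =>
    u k *: node (enum_val k))) // => k _; rewrite tE.
exists (fun j => if j \in K then a (enum_rank_in Kj0 j) else 0,
        fun j => if j \in K then b (enum_rank_in Kj0 j) else 0).
split=> [j /negPf /= ->//|p|p] /=; rewrite big_enum_val/=.
- have [<- _] := abP p; apply: eq_bigr => i _.
  by rewrite enum_valP enum_valK_in.
- have [_ pE] := abP p; rewrite -[RHS]pE; apply: eq_bigr => i _.
  by rewrite enum_valP enum_valK_in.
Qed.

Lemma is_bary_bary : is_bary K (bary K).
Proof. exact: xgetPex bary_exists. Qed.

Lemma lam_out j p : j \notin K -> lam K j p = 0.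
Proof.
have [out _ _] := is_bary_bary.
by move=> /out[a0 b0]; rewrite /lam a0 b0 addr0 dotvE mul0mx mxE.
Qed.

Lemma lam_sum p : \sum_(j in K) lam K j p = 1.
Proof. by have [_ + _] := is_bary_bary; exact. Qed.

Lemma lam_node p : \sum_(j in K) lam K j p *: node j = p.
Proof. by have [_ _ +] := is_bary_bary; exact. Qed.

Lemma lam_uniq (t : nodeT -> R) p : \sum_(j in K) t j = 1 ->
  p = \sum_(j in K) t j *: node j -> forall j, j \in K -> t j = lam K j p.
Proof.
move=> t1 tp j Kj; apply/eqP; rewrite -subr_eq0; apply/eqP.
apply: (Kindep (t := fun j => t j - lam K j p)) => //.
  by rewrite sumrB t1 lam_sum subrr.
rewrite (eq_bigr (fun j => t j *: node j - lam K j p *: node j)).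
  by rewrite sumrB -tp lam_node subrr.
by move=> i _; rewrite scalerBl.
Qed.

Lemma lam_vertex i j : i \in K -> lam K j (node i) = (i == j)%:R.
Proof.
move=> Ki; have [Kj|Kj] := boolP (j \in K); last first.
  by rewrite lam_out//; case: eqP Kj => // <-; rewrite Ki.
rewrite eq_sym; apply/esym.
apply: (lam_uniq (t := fun j => (j == i)%:R)) => //.
  rewrite (bigD1 i)//= eqxx big1 ?addr0// => k /andP[_ /negPf ->]//.
by rewrite (bigD1 i)//= eqxx scale1r big1 ?addr0// => k /andP[_ /negPf ->];
  rewrite scale0r.
Qed.

Lemma simplexP p : simplex K p <-> forall j, 0 <= lam K j p.
Proof.
split=> [[t [t0 t1 tp]] j|l0].
  have [Kj|Kj] := boolP (j \in K); last by rewrite lam_out.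
  by rewrite -(lam_uniq t1 tp).
by exists (fun j => lam K j p); split=> //; rewrite ?lam_sum ?lam_node.
Qed.

Lemma simplex_node i : i \in K -> simplex K (node i).
Proof. by move=> Ki; apply/simplexP => j; rewrite lam_vertex// ler0n. Qed.

Lemma affine_lam (c : V) (e : R) p :
  dotv c p + e = \sum_(j in K) lam K j p * (dotv c (node j) + e).
Proof.
under eq_bigr do rewrite mulrDr; rewrite big_split/= -mulr_suml lam_sum mul1r.
rewrite -[in LHS](lam_node p) dotv_sumr; congr (_ + _).
by apply: eq_bigr => j _; rewrite dotvZr.
Qed.

Lemma sub_open_simplex : open_simplex K `<=` simplex K.
Proof.
move=> p Kp; apply/simplexP => j.
by have [/Kp/ltW//|Kj] := boolP (j \in K); rewrite lam_out.
Qed.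

Lemma continuous_affine (c : V) (e : R) : continuous (fun p => dotv c p + e).
Proof.
have hc : continuous (dotv c).
  apply: continuous_big => [|i _ q]; first exact: add_continuous.
  apply: (@cvgM R _ (nbhs q) _ (fun=> c 0 i) (fun q => q 0 i) (c 0 i) (q 0 i)).
    exact: cvg_cst.
  exact: coord_continuous.
by move=> p; apply: (@cvgD R R^o _ (nbhs p) _ (dotv c) (fun=> e));
  [exact: hc|exact: cvg_cst].
Qed.

Lemma lam_continuous j : continuous (lam K j).
Proof. exact: continuous_affine. Qed.

Lemma open_open_simplex : open (open_simplex K).
Proof.
rewrite openE => p Kp.
have l0 j : \forall q \near p, j \in K -> 0 < lam K j q.
  have [Kj|Kj] := boolP (j \in K); last by near=> q.
  have h : \forall q \near p, 0 < lam K j q.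
    exact: (cvgr_gt (lam K j p) (@lam_continuous j p) _ (Kp j Kj)).
  by near=> q => _; near: q.
exact: (filter_forall _ l0).
Unshelve. all: by end_near. Qed.

Lemma closed_simplex : closed (simplex K).
Proof.
have -> : simplex K = \bigcap_(j in setT) (lam K j @^-1` [set x | 0 <= x]).
  by apply/seteqP; split=> p; [move/simplexP => h j _; exact: h|
    move=> h; apply/simplexP => j; exact: h].
apply: closed_bigI => j _.
by apply: closed_comp; [move=> ? _; exact: lam_continuous|exact: closed_ge].
Qed.

Lemma open_simplex_nonempty : open_simplex K !=set0.
Proof.
(* The barycentre, [K] having [d.+1] vertices. *)
exists (\sum_(j in K) d.+1%:R^-1 *: node j) => j Kj.
rewrite -(lam_uniq (t := fun=> d.+1%:R^-1))// ?invr_gt0 ?ltr0n//.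
by rewrite sumr_const Kcard -[_^-1 *+ _]mulr_natr mulVf// pnatr_eq0.
Qed.

Lemma interior_open_simplex p : open_simplex K p -> nbhs p (simplex K).
Proof.
move=> Kp; apply: filterS sub_open_simplex _.
exact: open_nbhs_nbhs (conj open_open_simplex Kp).
Qed.

(** Otherwise the coordinate would be constant, although it is 1 at [node j] and 0 at another
    vertex, which exists since [d > 0]. *)
Lemma bary_grad_neq0 j : (0 < d)%N -> j \in K -> (bary K).1 j != 0.
Proof.
move=> d0 Kj; have [i Ki ij] : exists2 i, i \in K & i != j.
  have /card_gt0P[i] : (0 < #|K :\ j|)%N.
    by have := cardsD1 j K; rewrite Kj Kcard add1n => -[<-].
  by rewrite !inE => /andP[ij Ki]; exists i.
apply/eqP => a0; have := lam_vertex j Ki; have := lam_vertex j Kj.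
rewrite /lam a0 !dotvE !mul0mx !mxE !add0r eqxx (negPf ij) => -> /eqP.
by rewrite oner_eq0.
Qed.

Lemma derive_affine (c : V) (e : R) p (i : 'I_d) :
  'D_(delta_mx 0 i) (fun p => dotv c p + e) p = c 0 i.
Proof.
apply: cvg_lim => //; apply: cvg_near_cst; near=> h.
have h0 : h != 0 by near: h; exact: nbhs_dnbhs_neq.
rewrite /= dotvDr dotvZr.
have -> : dotv c (delta_mx 0 i) = c 0 i.
  rewrite /dotv (bigD1 i)//= big1 ?addr0 => [|k ki];
    rewrite !mxE ?eqxx ?mulr1//=.
  by rewrite (negPf ki) mulr0.
rewrite [RHS](_ : _ = h^-1 * (h * c 0 i + dotv c p + e - (dotv c p + e)))//.
by field.
Unshelve. all: by end_near. Qed.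

Lemma grad_affine_on (v : V -> R) (c : V) (e : R) p :
  (forall q, simplex K q -> v q = dotv c q + e) -> open_simplex K p ->
  grad v p = c.
Proof.
move=> vE Kp; have vpE : \forall q \near p, v q = dotv c q + e.
  near=> q; apply: vE; near: q; exact: interior_open_simplex.
apply/rowP => i; rewrite mxE -(derive_affine c e p i).
exact: near_eq_derive.
Unshelve. all: by end_near. Qed.

End barycentric.

(** * Hat functions on a conforming mesh *)

Section conforming.
Context (R : realType) (d : nat) (Omega : set 'rV[R]_d) (Th : mesh R d).
Local Notation V := 'rV[R]_d.
Local Notation nodeT := 'I_(nb_nodes Th).
Local Notation node := (@node R d Th).
Implicit Types (K : {set nodeT}) (i j : nodeT) (p : V) (v : V -> R).
Hypothesis conf : conforming_mesh Omega Th.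

Let kc K (hK : K \in cells Th) := mesh_cell_card conf hK.
Let ki K (hK : K \in cells Th) := mesh_cell_indep conf hK.

(** Conformity puts [p] in the face [K :&: K']; its weights there, extended by zero, represent [p]
    in both simplices, so uniqueness applies twice. *)
Lemma lam_agree K K' p : K \in cells Th -> K' \in cells Th ->
  simplex K p -> simplex K' p -> forall j, lam K j p = lam K' j p.
Proof.
move=> hK hK' Kp K'p.
have : simplex (K :&: K') p by rewrite -(mesh_conforming conf hK hK').
move=> [t [t0 t1 tp]]; pose s j := if j \in K :&: K' then t j else 0.
have lamE (L : {set nodeT}) : L \in cells Th -> K :&: K' \subset L ->
    forall j, lam L j p = s j.
  move=> hL /fintype.subsetP sL j; have [Lj|Lj] := boolP (j \in L); last first.
    rewrite (lam_out (kc hL) (ki hL))// /s; case: ifPn => // /sL Lj'.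
    by rewrite Lj' in Lj.
  have LE j' : (j' \in L) && (j' \in K :&: K') = (j' \in K :&: K').
    by rewrite andb_idl// => /sL.
  apply/esym/(lam_uniq (kc hL) (ki hL)) => //; rewrite /s.
    by rewrite -big_mkcondr/= (eq_bigl _ _ LE).
  rewrite [LHS]tp -(eq_bigl _ _ LE) big_mkcondr/=; apply: eq_bigr => j' _.
  by case: ifP => // _; rewrite scale0r.
by move=> j; rewrite !lamE// ?subsetIl ?subsetIr.
Qed.

(** A point whose coordinates in [K] are all positive cannot lie in a cell missing a vertex of [K];
    equal cardinalities then identify the vertex sets. *)
Lemma open_simplex_inj K K' p : K \in cells Th -> K' \in cells Th ->
  open_simplex K p -> simplex K' p -> K = K'.
Proof.
move=> hK hK' Kp K'p; apply/eqP; rewrite eqEcard !kc// leqnn andbT.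
apply/fintype.subsetP => j Kj; apply: contraTT isT =>
  /(lam_out (kc hK') (ki hK')) l0.
have := Kp j Kj; rewrite (lam_agree hK hK' _ K'p) ?l0 ?ltxx//.
exact: (sub_open_simplex (kc hK) (ki hK)).
Qed.

Lemma open_simplex_Omega K : K \in cells Th -> open_simplex K `<=` Omega.
Proof.
move=> hK p Kp; apply: (mesh_interior conf hK).
exact: (interior_open_simplex (kc hK) (ki hK)).
Qed.

Lemma simplex_closure K : K \in cells Th -> simplex K `<=` closure Omega.
Proof. by move=> hK p Kp; rewrite (mesh_cover conf); exists K. Qed.

Lemma closure_simplex p : closure Omega p -> exists2 K,
  K \in cells Th & simplex K p.
Proof. by rewrite (mesh_cover conf) => -[K ? ?]; exists K. Qed.

Lemma node_closure i : closure Omega (node i).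
Proof.
have [K hK Ki] := mesh_node_cell conf i; apply: (simplex_closure hK).
exact: (simplex_node (kc hK) (ki hK)).
Qed.

Lemma Vh_lam v K p : Vh Omega Th v -> K \in cells Th -> simplex K p ->
  v p = \sum_j lam K j p * v (node j).
Proof.
move=> [_ +] hK Kp => /(_ K hK)[c [e vE]].
rewrite vE// (affine_lam (kc hK) (ki hK)) [RHS](bigID (mem K))/=.
rewrite [X in _ = _ + X]big1 ?addr0 => [|j Kj]; last first.
  by rewrite (lam_out (kc hK) (ki hK))// mul0r.
apply: eq_bigr => j Kj; rewrite vE//.
exact: (simplex_node (kc hK) (ki hK)).
Qed.

Lemma grad_Vh v K p : Vh Omega Th v -> K \in cells Th -> open_simplex K p ->
  grad v p = \sum_j v (node j) *: (bary K).1 j.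
Proof.
move=> vV hK; apply: (@grad_affine_on _ _ _ _ (kc hK) (ki hK) _ _
  (\sum_j v (node j) * (bary K).2 j)) => q Kq.
rewrite (Vh_lam vV hK Kq) dotv_suml -big_split/=.
by apply: eq_bigr => j _; rewrite dotvZl /lam; ring.
Qed.

Lemma within_bigsetU_continuous (I : choiceType) (s : seq I) (F : I -> set V) v
  :
  (forall k, k \in s -> closed (F k)) ->
  (forall k, k \in s -> {within F k, continuous v}) ->
  {within \bigcup_(k in [set` s]) F k, continuous v}.
Proof.
elim: s => [|k s IH] cF vF.
  have -> : \bigcup_(k in [set` [::]]) F k = set0 by apply/seteqP;
    split => x [].
  exact: continuous_subspace0.
have -> : \bigcup_(l in [set` k :: s]) F l = F k `|` \bigcup_(l in [set` s]) F
  l.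
  apply/seteqP; split => x.
    by move=> [l]; rewrite /= inE => /predU1P[->|ls] Fx; [left|right; exists l].
  move=> [Fx|[l ls Fx]]; first by exists k => //=; rewrite mem_head.
  by exists l => //=; rewrite inE [l \in s]ls orbT.
apply: withinU_continuous.
- by apply: cF; rewrite mem_head.
- apply: closed_bigcup; first exact: finite_seq.
  by move=> l /= ls; apply: cF; rewrite inE ls orbT.
- by apply: vF; rewrite mem_head.
- by apply: IH => l ls; [apply: cF|apply: vF]; rewrite inE ls orbT.
Qed.

(** Pick any cell containing [p] and use its coordinate; [lam_agree] makes the pick immaterial. Thus
    the [xget] defining [hat] does not fall back on its default. *)
Lemma hat_exists i : exists v, [/\ Vh Omega Th v,
  forall j, v (node j) = (i == j)%:R & forall p, ~ closure Omega p -> v p = 0].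
Proof.
pose sel p := [pick K in cells Th | `[< simplex K p >]].
pose v p := if sel p is Some K then lam K i p else 0.
have vE K p : K \in cells Th -> simplex K p -> v p = lam K i p.
  move=> hK Kp; rewrite /v /sel; case: pickP => [K' /andP[hK' /asboolP K'p]|].
    exact: lam_agree.
  by move=> /(_ K); rewrite hK/= => /asboolP.
exists v; split => [|j|p nOp].
- split.
    rewrite (mesh_cover conf) (_ : [set` cells Th] = [set` enum (cells Th)]);
      last first.
      by apply/seteqP; split=> K /=; rewrite mem_enum.
    apply: within_bigsetU_continuous => K; rewrite mem_enum => hK.
      exact: (closed_simplex (kc hK) (ki hK)).
    apply: (@subspace_eq_continuous _ _ _ (lam K i)).
      by move=> p; rewrite inE => Kp; apply/esym/vE.
    apply: continuous_subspaceT; exact: lam_continuous.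
  by move=> K hK; exists ((bary K).1 i), ((bary K).2 i) => p Kp; rewrite (vE K).
- have [K hK Kj] := mesh_node_cell conf j.
  have hj := simplex_node (kc hK) (ki hK) Kj.
  by rewrite (vE K)// (lam_vertex (kc hK) (ki hK))// eq_sym.
- rewrite /v /sel; case: pickP => // K /andP[hK /asboolP Kp].
  by exfalso; apply: nOp; exact: simplex_closure Kp.
Qed.

Lemma hatP i : [/\ Vh Omega Th (hat Omega i),
  forall j, hat Omega i (node j) = (i == j)%:R &
  forall p, ~ closure Omega p -> hat Omega i p = 0].
Proof. exact: xgetPex (hat_exists i). Qed.

Lemma hatE i K p : K \in cells Th -> simplex K p -> hat Omega i p = lam K i p.
Proof.
have [hV hn _] := hatP i; move=> hK Kp; rewrite (Vh_lam hV hK Kp).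
rewrite (bigD1 i)//= hn eqxx mulr1 big1 ?addr0// => j ji.
by rewrite hn eq_sym (negPf ji) mulr0.
Qed.

Lemma hat_ge0 i p : 0 <= hat Omega i p.
Proof.
have [_ _ h0] := hatP i; have [cp|/h0 ->//] := pselect (closure Omega p).
have [K hK Kp] := closure_simplex cp; rewrite (hatE _ hK)//.
by move: Kp => /(simplexP (kc hK) (ki hK)).
Qed.

Lemma hat_le1 i p : hat Omega i p <= 1.
Proof.
have [_ _ h0] := hatP i; have [cp|/h0 ->//] := pselect (closure Omega p).
have [K hK Kp] := closure_simplex cp; rewrite (hatE _ hK)//.
move: Kp => /(simplexP (kc hK) (ki hK)) l0.
have [Ki|Ki] := boolP (i \in K); last by rewrite (lam_out (kc hK) (ki hK)).
rewrite -(lam_sum (kc hK) (ki hK) p) (bigD1 i)//= lerDl.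
exact: sumr_ge0.
Qed.

Lemma grad_hat i K p : K \in cells Th -> open_simplex K p ->
  grad (hat Omega i) p = (bary K).1 i.
Proof.
have [hV hn _] := hatP i; move=> hK Kp; rewrite (grad_Vh hV hK Kp).
rewrite (bigD1 i)//= hn eqxx scale1r big1 ?addr0// => j ji.
by rewrite hn eq_sym (negPf ji) scale0r.
Qed.

(** The coordinates add up to 1 identically; comparing this affine identity at the points [s] and 0
    gives [dotv s s = 0]. *)
Lemma bary_grad_sum K : K \in cells Th -> \sum_j (bary K).1 j = 0.
Proof.
move=> hK; pose s := \sum_j (bary K).1 j.
have sE p : dotv s p + \sum_j (bary K).2 j = 1.
  rewrite dotv_suml -big_split/= -(lam_sum (kc hK) (ki hK) p) [RHS]big_mkcond/=.
  apply: eq_bigr => j _; case: ifPn => // Kj.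
  by rewrite -(lam_out (kc hK) (ki hK) p Kj).
apply/eqP; rewrite -/s -dotvv_eq0; apply/eqP.
have := sE s; rewrite -(sE 0) => /addIr ->.
by rewrite dotvC dotvE mul0mx mxE.
Qed.

End conforming.

(** * Integrals over the mesh *)

Section mesh_integrals.
Context (R : realType) (d : nat) (Omega : set 'rV[R]_d) (Th : mesh R d).
Local Notation V := 'rV[R]_d.
Local Notation L := (lebT R d).
Local Notation mu := (@leb R d).
Local Notation nodeT := 'I_(nb_nodes Th).
Local Notation node := (@node R d Th).
Implicit Types (K : {set nodeT}) (i j : nodeT) (p : V) (v : V -> R).
Hypothesis d0 : (0 < d)%N.
Hypothesis bOmega : bounded_set Omega.
Hypothesis conf : conforming_mesh Omega Th.

Let kc K (hK : K \in cells Th) := mesh_cell_card conf hK.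
Let ki K (hK : K \in cells Th) := mesh_cell_indep conf hK.

Definition vol K : R := fine (mu (open_simplex K)).

Lemma measurable_open_simplex K : measurable (open_simplex K : set L).
Proof.
have -> : open_simplex K = \bigcap_(j in [set j | j \in K])
    [set p | 0 < dotv ((bary K).1 j) p + (bary K).2 j] by [].
by apply: fin_bigcap_measurable => // j _; exact: measurable_halfspace.
Qed.

Lemma leb_open_simplex_lty K : K \in cells Th -> (mu (open_simplex K) < +oo)%E.
Proof.
move=> hK; have [r r0 Or] := bounded_cube bOmega.
apply: (@le_lt_trans _ _ (mu (cube 0 r))).
  apply: le_measure; rewrite ?inE.
  - exact: measurable_open_simplex.
  - by apply: measurable_cube; exact: ltW.
  - exact: subset_trans (open_simplex_Omega conf hK) Or.
by rewrite leb_cube ?ltry// ltW.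
Qed.

Lemma volE K : K \in cells Th -> (vol K)%:E = mu (open_simplex K).
Proof.
move=> hK; rewrite fineK// ge0_fin_numE; first exact: leb_open_simplex_lty.
exact: measure_ge0.
Qed.

Lemma vol_gt0 K : K \in cells Th -> 0 < vol K.
Proof.
move=> hK; rewrite -lte_fin volE//.
have [p Kp] := open_simplex_nonempty (kc hK) (ki hK).
apply: (@leb_nbhs_gt0 _ _ p); last exact: measurable_open_simplex.
by apply: open_nbhs_nbhs; split => //; exact: open_open_simplex.
Qed.

(** The full hyperplanes carrying the faces, not only the faces, so that nullity reduces to
    [leb_hyperplane]. *)
Definition skeleton : set V := [set p | exists K j,
  [/\ K \in cells Th, j \in K & lam K j p = 0]].

Lemma closure_skeleton p : closure Omega p -> ~ skeleton p ->
  exists2 K, K \in cells Th & open_simplex K p.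
Proof.
move=> /(closure_simplex conf)[K hK Kp] nsk; exists K => // j Kj.
move: Kp => /(simplexP (kc hK) (ki hK)) l0; rewrite lt0r l0 andbT.
by apply/eqP => lj; apply: nsk; exists K, j.
Qed.

Lemma negligible_skeleton : mu.-negligible (skeleton : set L).
Proof.
pose F (Kj : {set nodeT} * nodeT) : set V :=
  if (Kj.1 \in cells Th) && (Kj.2 \in Kj.1) then [set p | lam Kj.1 Kj.2 p = 0]
    else set0.
have nF Kj : mu.-negligible (F Kj : set L).
  rewrite /F; case: ifP => [/andP[hK Kj2]|_]; last exact: negligible_set0.
  have a0 := bary_grad_neq0 (kc hK) (ki hK) d0 Kj2.
  have mH : measurable ([set p | lam Kj.1 Kj.2 p = 0] : set L).
    have := measurable_affine ((bary Kj.1).1 Kj.2) ((bary Kj.1).2 Kj.2)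
      measurableT (measurable_set1 0).
    by rewrite setTI.
  by exists [set p | lam Kj.1 Kj.2 p = 0]; split => //; exact: leb_hyperplane.
have : mu.-negligible (\big[setU/set0]_(Kj <- index_enum _) F Kj : set L).
  by elim/big_ind : _ => //; [exact: negligible_set0|move=> A B;
    exact: (@negligibleU _ L _ mu)].
apply: negligibleS => p [K [j [hK Kj lj]]]; rewrite -bigcup_seq.
by exists (K, j); rewrite /= ?mem_index_enum// /F /= hK Kj.
Qed.

(** An explicitly measurable stand-in for functions controlled only inside the cells, such as
    gradients; it is 0 off the open cells. *)
Definition piecewise (c : {set nodeT} -> L -> R) (x : L) : R :=
  \sum_(K in cells Th) c K x * \1_(open_simplex K) x.

Lemma piecewise_open c K p : K \in cells Th -> open_simplex K p -> piecewise c
  p = c K p.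
Proof.
move=> hK Kp; rewrite /piecewise (bigD1 K)//= indicE mem_set// mulr1 big1
  ?addr0//.
move=> K' /andP[hK' K'K]; rewrite indicE memNset ?mulr0// => K'p.
have := open_simplex_inj conf hK' hK K'p (sub_open_simplex (kc hK) (ki hK) Kp).
by move=> K'E; rewrite K'E eqxx in K'K.
Qed.

Lemma piecewise_out c p : ~ Omega p -> piecewise c p = 0.
Proof.
move=> Op; rewrite /piecewise big1// => K hK; rewrite indicE memNset ?mulr0//.
by move=> /(open_simplex_Omega conf hK).
Qed.

Lemma measurable_piecewise c : (forall K, measurable_fun setT (c K)) ->
  measurable_fun setT (piecewise c).
Proof.
move=> mc; rewrite /piecewise; under eq_fun do rewrite big_mkcond/=.
apply: measurable_sum => K; case: (K \in cells Th); last exact: measurable_cst.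
apply: measurable_funM; first exact: mc.
by apply: measurable_indic; exact: measurable_open_simplex.
Qed.

Lemma integral_piecewise_cst (c : {set nodeT} -> R) :
  (\int[mu]_x (piecewise (fun K=> cst (c K)) x)%:E)%E =
  (\sum_(K in cells Th) c K * vol K)%:E.
Proof.
have intI K : K \in cells Th -> mu.-integrable setT (EFin \o \1_(open_simplex
  K) : L -> \bar R).
  move=> hK; apply/integrableP; split.
    by apply/measurable_EFinP/measurable_indic; exact: measurable_open_simplex.
  under eq_integral do rewrite /= ger0_norm//.
  rewrite integral_indic//; last exact: measurable_open_simplex.
  by rewrite setIT; exact: leb_open_simplex_lty.
under eq_integral do rewrite /piecewise -sumEFin big_mkcond/=.
rewrite integral_sum//; last first.
  move=> K; case: (boolP (K \in cells Th)) => hK; last exact: integrable0.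
  by under eq_fun do rewrite EFinM; exact: integrableZl (intI _ hK).
rewrite -sumEFin [RHS]big_mkcond/=; apply: eq_bigr => K _.
case: (boolP (K \in cells Th)) => hK.
  under eq_integral do rewrite EFinM.
  rewrite integralZl//; last exact: intI.
  rewrite integral_indic//; last exact: measurable_open_simplex.
  by rewrite setIT EFinM volE.
by rewrite integral0.
Qed.

(** Completeness of the measure transfers measurability to [g], however [g] behaves on the
    exceptional null set. *)
Lemma ae_eq_measurable_setT (f g : L -> \bar R) : ae_eq mu setT f g ->
  measurable_fun setT f ->
  measurable_fun setT g /\ (\int[mu]_x g x = \int[mu]_x f x)%E.
Proof.
move=> fg mf; have mg := ae_measurable_fun (@leb_is_complete R d) fg mf.
by split => //; apply: ae_eq_integral => //; exact: ae_eq_sym.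
Qed.

(** Off the skeleton, a point of [Omega] lies in an open cell; a point outside [Omega] lies in none.
    So the two functions agree almost everywhere, whatever [v] does on the faces. *)
Lemma piecewise_ae (c : {set nodeT} -> L -> R) v :
  (forall K, measurable_fun setT (c K)) ->
  (forall K p, K \in cells Th -> open_simplex K p -> v p = c K p) ->
  measurable_fun setT (fun x : L => ((v \_ Omega) x)%:E) /\
  (\int[mu]_x ((v \_ Omega) x)%:E = \int[mu]_x (piecewise c x)%:E)%E.
Proof.
move=> mc vc.
apply: ae_eq_measurable_setT; last exact/measurable_EFinP/measurable_piecewise.
apply: negligibleS negligible_skeleton => p /= ne; apply: contrapT => nsk.
apply: ne => _; rewrite patchE; case: ifPn => [|];
  rewrite ?inE ?notin_setE => Op.
  have [K hK Kp] := closure_skeleton (@subset_closure _ Omega p Op) nsk.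
  by rewrite (piecewise_open _ hK Kp) (vc K p hK Kp).
by rewrite piecewise_out.
Qed.

Lemma integral_vec_piecewise (c : {set nodeT} -> R) v :
  (forall K p, K \in cells Th -> open_simplex K p -> v p = c K) ->
  integral_vec Omega v = \sum_(K in cells Th) c K * vol K.
Proof.
move=> vc; rewrite /integral_vec Rintegral_mkcond /Rintegral.
have [|_ ->] := @piecewise_ae (fun K => cst (c K)) v _ vc.
  by move=> K; exact: measurable_cst.
by rewrite integral_piecewise_cst.
Qed.

(** Two halves are required, because [fine] sends an infinite value to 0: a positive lower bound
    near an inner point of a cell, and finiteness from an enclosing cube. *)
Lemma integral_hat_gt0 i : 0 < integral_vec Omega (hat Omega i).
Proof.
have [m h] := @piecewise_ae (fun K => lam K i) (hat Omega i)
  (fun K => measurable_affine _ _)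
  (fun K p hK Kp => hatE conf i hK (sub_open_simplex (kc hK) (ki hK) Kp)).
have [K hK Ki] := mesh_node_cell conf i.
have [p Kp] := open_simplex_nonempty (kc hK) (ki hK).
(* Half the value at [p], so that the hat function exceeds [c] on a neighbourhood of [p]. *)
pose c := lam K i p / 2; have c0 : 0 < c by rewrite divr_gt0// Kp.
pose U := open_simplex K `&` [set q | 0 < dotv ((bary K).1 i) q + ((bary K).2 i
  - c)].
have mU : measurable (U : set L).
  by apply: measurableI; [exact: measurable_open_simplex|exact:
    measurable_halfspace].
have Up : nbhs p U.
  apply: filterI; first by apply: open_nbhs_nbhs; split => //;
    exact: open_open_simplex.
  have h0 : 0 < dotv ((bary K).1 i) p + ((bary K).2 i - c).
    by have := Kp i Ki; rewrite addrA -/(lam K i p) /c; lra.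
  exact: (cvgr_gt _ (@continuous_affine R d ((bary K).1 i) ((bary K).2 i - c)
    p) _ h0).
have U0 : (0 < mu U)%E by exact: leb_nbhs_gt0 Up mU.
have h0 q : 0 <= (hat Omega i \_ Omega) q.
  by rewrite patchE; case: ifP => // _; exact: hat_ge0.
rewrite /integral_vec Rintegral_mkcond /Rintegral; apply: fine_gt0;
  apply/andP; split.
  apply: (@lt_le_trans _ _ (\int[mu]_x (c * \1_U x)%:E)%E).
    have cU : c < 0 -> U = set0 by move=> /(lt_trans c0); rewrite ltxx.
    rewrite (@integralZl_indic _ _ _ mu _ measurableT (fun=> U) c cU mU).
    by rewrite integral_indic// setIT mule_gt0.
  apply: ge0_le_integral.
  - exact: measurableT.
  - by move=> x _; rewrite lee_fin mulr_ge0// ltW.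
  - apply/measurable_EFinP/measurable_funM; first exact: measurable_cst.
    exact: measurable_indic.
  - exact: m.
  - move=> x _; rewrite lee_fin indicE.
    have [/set_mem[Kx xc]|_] := boolP (x \in U); last by rewrite mulr0.
    rewrite mulr1 patchE mem_set; last exact: (open_simplex_Omega conf hK).
    rewrite (hatE conf i hK (sub_open_simplex (kc hK) (ki hK) Kx)).
    by move: xc => /=; rewrite addrA -/(lam K i x); lra.
have [r r0 Or] := bounded_cube bOmega.
have mr : measurable (cube 0 r : set L) by apply: measurable_cube; exact: ltW.
apply: (@le_lt_trans _ _ (\int[mu]_x (\1_(cube 0 r) x)%:E)%E).
  apply: ge0_le_integral.
  - exact: measurableT.
  - by move=> x _; rewrite lee_fin.
  - exact: m.
  - by apply/measurable_EFinP/measurable_indic.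
  - move=> x _; rewrite lee_fin patchE indicE.
    have [/set_mem/Or/mem_set ->|_] := boolP (x \in Omega); last by [].
    exact: hat_le1.
by rewrite integral_indic// setIT [ltLHS](leb_cube 0 (ltW r0)) ltry.
Qed.

End mesh_integrals.

(** * The discrete maximum principle *)

Section discrete_maximum.
Context (R : realType) (d : nat) (Omega : set 'rV[R]_d) (Th : mesh R d).
Local Notation V := 'rV[R]_d.
Local Notation nodeT := 'I_(nb_nodes Th).
Local Notation node := (@node R d Th).
Implicit Types (K : {set nodeT}) (i j : nodeT) (p : V) (v : V -> R).
Hypothesis d0 : (0 < d)%N.
Hypothesis bOmega : bounded_set Omega.
Hypothesis conf : conforming_mesh Omega Th.
Local Notation stiff := (@stiffness R d Omega Th).
Local Notation g K j := ((bary K).1 j).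

Let kc K (hK : K \in cells Th) := mesh_cell_card conf hK.
Let ki K (hK : K \in cells Th) := mesh_cell_indep conf hK.

Lemma stiffnessE i j :
  stiff i j = \sum_(K in cells Th) dotv (g K i) (g K j) * vol K.
Proof.
apply: (integral_vec_piecewise d0 bOmega conf) => K p hK Kp.
by rewrite !(grad_hat conf _ hK Kp).
Qed.

Lemma stiffness_grad w i : Vh Omega Th w ->
  integral_vec Omega (fun x => dotv (grad w x) (grad (hat Omega i) x)) =
  \sum_j w (node j) * stiff i j.
Proof.
move=> wV; rewrite (integral_vec_piecewise d0 bOmega conf
  (c := fun K => \sum_j w (node j) * dotv (g K i) (g K j))); last first.
  move=> K p hK Kp; rewrite (grad_hat conf _ hK Kp) (grad_Vh conf wV hK Kp).
  by rewrite dotv_suml; apply: eq_bigr => j _; rewrite dotvZl dotvC.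
under eq_bigr do rewrite mulr_suml.
rewrite exchange_big/=; apply: eq_bigr => j _.
by rewrite stiffnessE mulr_sumr; apply: eq_bigr => K _; rewrite mulrA.
Qed.

(** The hat functions form a partition of unity, so on each cell their gradients add up to zero. *)
Lemma stiffness_sum i : \sum_j stiff i j = 0.
Proof.
under eq_bigr do rewrite stiffnessE.
rewrite exchange_big/= big1// => K hK.
rewrite -mulr_suml -dotv_sumr (bary_grad_sum conf hK).
by rewrite dotvC dotvE mul0mx mxE mul0r.
Qed.

Lemma maximum_propagates w (m : R) K i j :
  weakly_acute Omega Th -> Vh Omega Th w ->
  (forall i, w (node i) <= m) ->
  (forall i, w (node i) = m ->
    integral_vec Omega (fun x => dotv (grad w x) (grad (hat Omega i) x)) <= 0)
      ->
  K \in cells Th -> i \in K -> j \in K -> w (node i) = m -> w (node j) = m.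
Proof.
move=> acute wV wm subsol hK Ki Kj wi.
pose S := [pred i | w (node i) == m].
have sym a b : stiff a b = stiff b a.
  by rewrite !stiffnessE; apply: eq_bigr => *; rewrite dotvC.
have zero a b : a \in S -> b \notin S -> stiff a b = 0.
  move=> /eqP Sa Sb; have := subsol a Sa; rewrite (stiffness_grad _ wV).
  (* Row sums of the stiffness matrix vanish, so subtracting [m] from all nodal values changes
     nothing and gives every off-diagonal term a sign. *)
  have -> : \sum_j w (node j) * stiff a j = \sum_j (w (node j) - m) * stiff a j.
    under [RHS]eq_bigr do rewrite mulrBl.
    by rewrite sumrB -mulr_sumr stiffness_sum mulr0 subr0.
  have ge0 c : 0 <= (w (node c) - m) * stiff a c.
    have [->|ac] := eqVneq c a; first by rewrite Sa subrr mul0r.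
    by rewrite mulr_le0// ?subr_le0//; apply: acute; rewrite eq_sym.
  move=> le0; have : \sum_j (w (node j) - m) * stiff a j == 0.
    by rewrite eq_le le0 sumr_ge0.
  rewrite psumr_eq0// => /allP/(_ b (mem_index_enum _)).
  rewrite /= mulf_eq0 subr_eq0; move: Sb; rewrite inE => /negPf -> /=.
  by move/eqP.
pose G L := \sum_(a in S) g L a.
have energy : \sum_(L in cells Th) dotv (G L) (G L) * vol L = 0.
  transitivity (\sum_(a in S) \sum_(b in S) stiff a b).
    under [RHS]eq_bigr do under eq_bigr do rewrite stiffnessE.
    under [RHS]eq_bigr do rewrite exchange_big/=.
    rewrite exchange_big/=; apply: eq_bigr => L _.
    rewrite /G dotv_suml mulr_suml; apply: eq_bigr => a _.
    by rewrite dotv_sumr mulr_suml.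
  (* For [a] in [S] the entries outside [S] vanish, so the partial row sum over [S] equals the full
     one, which is 0. *)
  rewrite big1// => a Sa; rewrite -[RHS](stiffness_sum a) [RHS](bigID (mem
    S))/=.
  by rewrite [X in _ = _ + X]big1 ?addr0// => b Sb; exact: zero.
have G0 : G K = 0.
  move/eqP: energy; rewrite psumr_eq0 => [/allP/(_ K (mem_index_enum _))|L hL].
    rewrite hK/= mulf_eq0 (gt_eqF (vol_gt0 bOmega conf hK)) orbF.
    by rewrite dotvv_eq0 => /eqP.
  by rewrite mulr_ge0 ?dotvv_ge0// ltW// (vol_gt0 bOmega conf hL).
(* On the cell [K], the sum of the hat functions of [S]. Zero gradient makes it constant, while at a
   vertex it is 1 or 0 according to membership in [S]. *)
pose chi p := \sum_(a in S) lam K a p.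
have chiE p q : chi p = chi q.
  have chi_affine r : chi r = \sum_(a in S) (bary K).2 a.
    by rewrite /chi /lam big_split/= -dotv_suml -/(G K) G0 dotvE mul0mx mxE
      add0r.
  by rewrite !chi_affine.
have chi_node a : a \in K -> chi (node a) = (a \in S)%:R.
  move=> Ka; rewrite /chi.
  under eq_bigr do rewrite (lam_vertex (kc hK) (ki hK) _ Ka).
  have [Sa|Sa] := boolP (a \in S).
    rewrite (bigD1 a)//= eqxx big1 ?addr0// => b /andP[_ /negPf].
    by rewrite eq_sym => ->.
  by rewrite big1// => b Sb; case: eqP Sa => // ->; rewrite Sb.
have := chiE (node i) (node j); rewrite !chi_node// !inE wi eqxx.
by case: eqP => //= _ /eqP; rewrite oner_eq0.
Qed.

(** A node with largest [k]-th coordinate bounds that coordinate on all of [closure Omega], a union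
    of convex hulls of nodes; were it interior, a small step in direction [k] would exceed the
    bound. *)
Lemma boundary_node (i0 : nodeT) : open Omega ->
  exists j, boundary Omega (node j).
Proof.
move=> oO; pose k : 'I_d := Ordinal d0.
have [j _ jmax] := @arg_maxP _ _ _ i0 xpredT (fun j => node j 0 k) isT.
exists j; split; first exact: node_closure.
move=> /= nj; have [r r0 rO] := nbhs_cube nj.
have : Omega (node j + r *: delta_mx 0 k).
  apply: rO => l; rewrite !mxE eqxx /=.
  by case: eqP => _; rewrite ?mulr1 ?mulr0; lra.
move=> /(@subset_closure _ Omega)/(closure_simplex conf)[K hK Kp].
have := lam_node (kc hK) (ki hK) (node j + r *: delta_mx 0 k).
set p := node j + _ in Kp * => /matrixP/(_ 0 k) pE.
have : p 0 k <= node j 0 k.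
  rewrite -pE summxE -[leRHS]mul1r -(lam_sum (kc hK) (ki hK) p) mulr_suml.
  apply: ler_sum => a Ka; rewrite mxE; apply: ler_wpM2l; last exact: jmax.
  by move: Kp => /(simplexP (kc hK) (ki hK)).
suff -> : p 0 k = node j 0 k + r by lra.
by rewrite !mxE !eqxx mulr1.
Qed.

(* The union of the simplices on which [w] equals [m] and the union of the
   others are disjoint closed sets, and [Omega] is connected. *)
Lemma maximum_boundary w (m : R) i :
  open Omega -> connected Omega -> Vh Omega Th w ->
  (forall j, w (node j) <= m) ->
  (forall K a b, K \in cells Th -> a \in K -> b \in K ->
     w (node a) = m -> w (node b) = m) ->
  Omega (node i) -> w (node i) = m -> exists2 p, boundary Omega p & w p = m.
Proof.
move=> oO cO wV wm prop Oi wi.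
pose P K := [forall a in K, w (node a) == m].
pose U (b : bool) : set V := \bigcup_(K in [set` [pred K in cells Th | P K ==
  b]]) simplex K.
have cU b : closed (U b).
  apply: closed_bigcup; first exact: finite_finset.
  by move=> K /andP[hK _]; exact: closed_simplex (kc hK) (ki hK).
have Utrue p : U true p -> w p = m.
  move=> [K /= /andP[hK /eqP/forall_inP PK] Kp].
  rewrite (Vh_lam conf wV hK Kp) -[RHS]mul1r -(lam_sum (kc hK) (ki hK) p).
  rewrite mulr_suml [RHS]big_mkcond/=; apply: eq_bigr => j _.
  case: ifPn => [/PK/eqP -> //|Kj].
  by rewrite (lam_out (kc hK) (ki hK) p Kj) mul0r.
have Ufalse p : U false p -> w p < m.
  move=> [K /= /andP[hK /eqP/negbT]]; rewrite negb_forall_in.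
  move=> /exists_inP[a Ka wa] Kp.
  have wKm j : j \in K -> w (node j) < m.
    move=> Kj; rewrite lt_neqAle wm andbT; apply: contra wa => /eqP wj.
    by apply/eqP; exact: (prop K j a hK Kj Ka wj).
  have l0 := (simplexP (kc hK) (ki hK) p).1 Kp.
  rewrite (Vh_lam conf wV hK Kp) -subr_gt0.
  have -> : m - \sum_j lam K j p * w (node j) =
      \sum_(j in K) lam K j p * (m - w (node j)).
    under [RHS]eq_bigr do rewrite mulrBr.
    rewrite sumrB -mulr_suml (lam_sum (kc hK) (ki hK)) mul1r; congr (_ - _).
    rewrite [RHS]big_mkcond/=; apply: eq_bigr => j _; case: ifPn => // Kj.
    by rewrite (lam_out (kc hK) (ki hK) p Kj) mul0r.
  have pos j : j \in K -> 0 <= lam K j p * (m - w (node j)).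
    by move=> Kj; rewrite mulr_ge0// subr_ge0.
  rewrite lt_neqAle sumr_ge0// andbT; apply/eqP => /esym/eqP.
  rewrite psumr_eq0// => /allP s0.
  have := lam_sum (kc hK) (ki hK) p; rewrite big1 => [/esym/eqP|j Kj].
    by rewrite oner_eq0.
  have := s0 j (mem_index_enum _); rewrite Kj/= mulf_eq0 subr_eq0.
  by rewrite (gt_eqF (wKm _ Kj)) orbF => /eqP.
have Ucover p : closure Omega p -> U true p \/ U false p.
  move=> /(closure_simplex conf)[K hK Kp].
  by case PK : (P K); [left|right]; exists K => //=; rewrite inE hK PK eqxx.
have OU : Omega `&` U true = Omega.
  apply: cO.
  - exists (node i); split => //.
    have [//|/Ufalse] := Ucover _ (subset_closure Oi).
    by rewrite wi ltxx.
  - exists (~` U false); first exact/closed_openC.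
    apply/seteqP; split => p [Op Up]; split => //.
      by move=> /Ufalse; rewrite (Utrue _ Up) ltxx.
    by have [] := Ucover _ (subset_closure Op).
  - by exists (U true).
(* [Omega] lies in the closed set [U true], hence so does its closure, which contains a boundary
   node. *)
have [j bj] := boundary_node i oO; exists (node j) => //; apply: Utrue.
apply: (cU true); have [cj _] := bj; apply: closure_subset cj.
by rewrite -OU; exact: subIsetr.
Qed.

End discrete_maximum.

(** * The nonlocal operator *)

Section admissible_steps.
Context (R : realType) (d : nat) (Omega : set 'rV[R]_d).
Local Notation V := 'rV[R]_d.
Implicit Types (x y z : V) (r t : R).
Hypothesis oOmega : open Omega.

Lemma continuous_ray x z : continuous (fun t : R => x + t *: z).
Proof.
move=> t; apply: (@cvgD R V R (nbhs t) _ (fun=> x) (fun s => s *: z)).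
  exact: cvg_cst.
exact: scalel_continuous.
Qed.

Lemma closure_ray x z : (forall t, 0 <= t < 1 -> Omega (x + t *: z)) ->
  closure Omega (x + z).
Proof.
move=> Oz U; rewrite -{1}(scale1r z) => /continuous_ray/nbhs_ballP[e /= e0 eU].
pose t := Num.max 0 (1 - e / 2).
have t01 : 0 <= t < 1.
  by rewrite /t le_max lexx/= gt_max ltr01/=; have e0' : 0 < e := e0; lra.
exists (x + t *: z); split; first exact: Oz.
apply: eU; rewrite /ball/= ger0_norm; last by case/andP: t01 => *; lra.
have : 1 - e / 2 <= t by rewrite /t le_max lexx orbT.
by lra.
Qed.

(** The segment from [x] to [x + y] stays closer to [x] than any boundary point, so the parameters
    landing in [Omega] form a set both open and closed in [[0, 1]], and it contains 0. *)
Lemma segment_dist_boundary r x y : Omega x -> r < dist_boundary Omega x ->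
  enorm y <= r -> Omega (x + y).
Proof.
move=> Ox rx yr; pose f (t : R) := x + t *: y.
pose B := `[0, 1]%classic `&` f @^-1` Omega.
have BE : B = `[0, 1]%classic `&` f @^-1` (closure Omega).
  apply/seteqP; split => t /= [t01 ft]; split => //;
    first exact: subset_closure.
  apply: contrapT => nft.
  have bt : boundary Omega (f t) by split => // /interior_subset.
  have : dist_boundary Omega x <= enorm (x - f t).
    apply: ge_inf; last by exists (f t).
    by exists 0 => _ [z _ <-]; exact: enorm_ge0.
  apply/negP; rewrite -ltNge; apply: le_lt_trans rx; apply: le_trans yr.
  rewrite /f opprD addrA subrr add0r -scaleNr enormZ normrN.
  move: t01; rewrite in_itv/= => /andP[t0 t1].
  by rewrite ger0_norm// ler_piMl// enorm_ge0.
have fc : continuous f by exact: continuous_ray.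
have -> : x + y = f 1 by rewrite /f scale1r.
have [//] : B 1.
suff -> : B = `[0, 1]%classic by rewrite /= in_itv/= ler01 lexx.
apply: (@segment_connected R 0 1).
- by exists 0; split; rewrite /= ?in_itv/= ?lexx ?ler01// /f scale0r addr0.
- by exists (f @^-1` Omega) => //; apply: open_comp => // t _; exact: fc.
- exists (f @^-1` (closure Omega)) => //.
  by apply: closed_comp => [t _|]; [exact: fc|exact: closed_closure].
Qed.

(** When [theta] is a supremum, both it and the closed ball are limits of admissible data: shorten
    the step by a factor [s < 1], land in [Omega], and let [s] tend to 1 by [closure_ray]. *)
Lemma theta_closure r x y : Omega x -> 0 < r -> enorm y <= r ->
  closure Omega (x + theta Omega r x *: y).
Proof.
move=> Ox r0 yr; rewrite /theta; case: ifPn => [rx|_].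
  by rewrite scale1r; apply: subset_closure; exact: segment_dist_boundary yr.
set T := [set t | _].
(* The empty set has supremum 0 by convention, and the point is then [x] itself. *)
have [->|/set0P T0] := eqVneq T set0.
  by rewrite sup0 scale0r addr0; exact: subset_closure.
have hT : has_sup T by split => //; exists 1 => t [/andP[]].
have sT0 : 0 < sup T.
  have [t Tt] := T0; apply: (@lt_le_trans _ _ t); first by case: Tt => /andP[].
  by apply: ub_le_sup => //; case: hT.
apply: closure_ray => s /andP[s0 s1].
have [t Tt st] : exists2 t, T t & s * sup T < t.
  by apply: sup_gt => //; rewrite gtr_pMl.
have [/andP[t0 t1] Oy] := Tt.
(* The shortened step is [t] times a vector of norm less than [r], so admissibility of [t]
   applies. *)
have [] := Oy ((s * sup T / t) *: y).
  rewrite enormZ ger0_norm; last by rewrite divr_ge0 ?mulr_ge0// ltW.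
  have c1 : s * sup T / t < 1 by rewrite ltr_pdivrMr// mul1r.
  have := enorm_ge0 y; rewrite le_eqVlt => /predU1P[<-|y0];
    first by rewrite mulr0.
  by apply: lt_le_trans yr; rewrite gtr_pMl.
by rewrite !scalerA [t * _]mulrC divfK ?gt_eqF// => + _.
Qed.

End admissible_steps.

(** No measurability or integrability is assumed: the positive part vanishes on [D], and if the
    integral is [-oo] then [fine] returns 0. *)
Lemma Rintegral_le0 (d : measure_display) (T : measurableType d) (R : realType)
    (mu : {measure set T -> \bar R}) (D : set T) (f : T -> R) :
  (forall x, D x -> f x <= 0) -> \int[mu]_(x in D) f x <= 0.
Proof.
move=> f0; rewrite /Rintegral; apply: fine_le0; rewrite integralE.
rewrite [X in (X - _)%E]integral0_eq => [|x Dx]; last first.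
  by rewrite funeposE; apply/max_idPr; rewrite lee_fin f0.
by rewrite sub0e oppe_le0; apply: integral_ge0 => x _; exact: funeneg_ge0.
Qed.

Lemma Rintegral_sum (d : measure_display) (T : measurableType d) (R : realType)
    (mu : {measure set T -> \bar R}) (D : set T) (I : Type) (s : seq I)
    (f : I -> T -> R) : measurable D ->
  (forall i, mu.-integrable D (EFin \o f i)) ->
  \int[mu]_(x in D) (\sum_(i <- s) f i x) = \sum_(i <- s) \int[mu]_(x in D) f i
    x.
Proof.
move=> mD intf; rewrite /Rintegral.
under eq_integral do rewrite -sumEFin.
rewrite integral_sum// [in RHS](_ : \sum_(i <- s) _ =
    fine (\sum_(i <- s) (fine (\int[mu]_(x in D) (f i x)%:E)%E)%:E)%E).
  by congr fine; apply: eq_bigr => i _; rewrite fineK//;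
    exact: integrable_fin_num (intf i).
by rewrite sumEFin.
Qed.

Section nonlocal.
Context (R : realType) (d : nat) (Omega : set 'rV[R]_d) (Th : mesh R d).
Local Notation V := 'rV[R]_d.
Local Notation nodeT := 'I_(nb_nodes Th).
Local Notation node := (@node R d Th).
Variables (A : V -> 'M[R]_d) (lambda Lambda eps : R) (phi : V -> R).
Hypothesis d0 : (0 < d)%N.
Hypothesis oOmega : open Omega.
Hypotheses (lambda0 : 0 < lambda) (lamLam : lambda <= Lambda) (eps0 : 0 < eps).
Hypothesis hphi : kernel_ok phi.

Lemma sqrtmxP (S : 'M[R]_d) :
  sqrtmx S = 0 \/ [/\ (sqrtmx S)^T = sqrtmx S, forall xi,
    0 <= qform (sqrtmx S) xi
    & sqrtmx S *m sqrtmx S = S].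
Proof.
rewrite /sqrtmx; case: xgetP => [M _ MP|_]; [by right|by left].
Qed.

Lemma I_eps_le0 (w : V -> R) (i : nodeT) : Omega (node i) ->
  (forall xi, qform (Abar Omega A i) xi <= Lambda * dotv xi xi) ->
  (forall p, closure Omega p -> w p <= w (node i)) ->
  I_eps Omega A lambda Lambda eps phi w i <= 0.
Proof.
move=> Oi AL wmax; apply: Rintegral_le0 => y _.
have [phi0 _ _ [_ phisupp] _] := hphi.
set M := Mmx _ _ _ _; set r := _ * eps.
have Q1 : 0 < Lambda - lambda / 2.
  by move: lambda0 lamLam; move: (lambda) (Lambda) => a b; lra.
have Q0 := ltW Q1.
have r0 : 0 < r by rewrite mulr_gt0// sqrtr_gt0.
have [M0|[MT Mpsd MM]] := sqrtmxP (Abar Omega A i - (lambda / 2)%:M).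
  (* The dummy root 0 has determinant 0 as [d > 0], and division by 0 gives 0, so the integrand
     vanishes. *)
  rewrite (_ : \det M = 0) ?mulr0 ?invr0 ?mulr0 ?mul0r//.
  rewrite /M /Mmx M0; case: d d0 => // d' _; exact: det0.
rewrite -/(Mmx _ _ _ _) -/M in MT Mpsd MM.
have detM0 : 0 <= \det M by exact: det_psd_ge0.
have [detM|detMn0] := eqVneq (\det M) 0.
  by rewrite detM mulr0 invr0 mulr0 mul0r.
have uM : M \in unitmx by rewrite unitmxE unitfE.
have [->|phin0] := eqVneq (phi (eps^-1 *: (y *m invmx M))) 0;
  first by rewrite mulr0.
have yr : enorm y <= r.
  have : enorm (eps^-1 *: (y *m invmx M)) <= 1.
    by apply: phisupp; apply: subset_closure.
  rewrite enormZ gtr0_norm ?invr_gt0// mulrC ler_pdivrMr// mul1r.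
  set z := y *m invmx M => zeps.
  have -> : y = z *m M by rewrite mulmxKV.
  (* Symmetry of [M] turns the left side into the quadratic form of [M *m M], that is of [Abar]
     minus [lambda / 2]; its upper bound for [enorm z <= eps] is exactly [r ^+ 2]. *)
  have : enorm (z *m M) ^+ 2 <= r ^+ 2.
    rewrite sqr_enorm dotvE trmx_mul MT !mulmxA -(mulmxA z) MM.
    rewrite -/(qform _ _) qformB qform_scalar /r exprMn sqr_sqrtr//.
    apply: (@le_trans _ _ ((Lambda - lambda / 2) * dotv z z)).
      by rewrite mulrBl lerB.
    rewrite ler_wpM2l//.
    by rewrite -sqr_enorm ler_pXn2r// nnegrE ?enorm_ge0// ltW.
  by rewrite ler_pXn2r// nnegrE ?enorm_ge0// ltW.
rewrite mulr_le0_ge0//.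
rewrite mulr_le0_ge0//; last by rewrite invr_ge0 mulr_ge0// exprn_ge0// ltW.
rewrite /second_diff mulr_ge0_le0//; first by rewrite invr_ge0 sqr_ge0.
have w1 := wmax _ (theta_closure oOmega Oi r0 yr).
have w2 : w (node i - theta Omega r (node i) *: y) <= w (node i).
  by apply: wmax; rewrite -scalerN; apply: theta_closure; rewrite ?enormN.
by lra.
Qed.

End nonlocal.

(** * The upper bound for the nodal coefficient [Abar] *)

Section averaged_coefficient.
Context (R : realType) (d : nat) (Omega : set 'rV[R]_d) (Th : mesh R d).
Local Notation V := 'rV[R]_d.
Local Notation L := (lebT R d).
Local Notation mu := (@leb R d).
Local Notation nodeT := 'I_(nb_nodes Th).
Local Notation node := (@node R d Th).
Implicit Types (K : {set nodeT}) (i j : nodeT) (p : V) (v : V -> R).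
Hypothesis d0 : (0 < d)%N.
Hypothesis bOmega : bounded_set Omega.
Hypothesis oOmega : open Omega.
Hypothesis conf : conforming_mesh Omega Th.
Variables (A : V -> 'M[R]_d) (lambda Lambda : R).
Hypotheses (lambda0 : 0 < lambda) (lamLam : lambda <= Lambda).
Hypothesis hA : coefficient_ok Omega A lambda Lambda.

Let kc K (hK : K \in cells Th) := mesh_cell_card conf hK.
Let ki K (hK : K \in cells Th) := mesh_cell_indep conf hK.

Lemma qform_continuous z : continuous (fun M : 'M[R]_d => qform M z).
Proof.
have -> : (fun M => qform M z) =
    (fun M : 'M[R]_d => \sum_k \sum_l z 0 k * z 0 l * M k l).
  by apply/funext => M; exact: qformE.
apply: continuous_big => [|k _]; first exact: add_continuous.
apply: continuous_big => [|l _ N]; first exact: add_continuous.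
apply: (@cvgM R _ (nbhs N) _ (fun=> z 0 k * z 0 l) (fun N => N k l)).
  exact: cvg_cst.
exact: coord_continuous.
Qed.

(** A violation at [x] would persist on a neighbourhood by continuity, and that neighbourhood would
    lie in the null set where the bounds on [A] may fail. *)
Lemma qform_le_continuous z x : {within Omega, continuous A} -> Omega x ->
  qform (A x) z <= Lambda * dotv z z.
Proof.
rewrite continuous_open_subspace// => cA Ox; rewrite leNgt; apply/negP => lt.
have [_ _ [N [mN N0 subN]]] := hA.
have ncA : \forall y \near x, Lambda * dotv z z < qform (A y) z.
  have h : (fun y => qform (A y) z) @ x --> qform (A x) z.
    apply: (@cvg_comp _ _ _ A (fun M => qform M z)); first by apply: cA;
      rewrite inE.
    exact: qform_continuous.
  exact: (cvgr_gt _ h _ lt).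
have nN : nbhs x N.
  near=> y; apply: subN => /= h.
  have [|_ /(_ z)] := h _; first by near: y; exact: open_nbhs_nbhs.
  by rewrite qform_scalar leNgt; apply/negP; rewrite negbK; near: y.
by have := leb_nbhs_gt0 nN mN; rewrite [X in (_ < X)%E]N0 ltxx.
Unshelve. all: by end_near. Qed.

Lemma Rintegral_ae_domain (D W : set L) (v : L -> R) : measurable W ->
  mu.-negligible (D `\` W) -> W `<=` D -> measurable_fun W v ->
  \int[mu]_(x in D) v x = \int[mu]_(x in W) v x.
Proof.
move=> mW nDW WD mv; rewrite Rintegral_mkcond [RHS]Rintegral_mkcond /Rintegral.
congr fine.
apply: (proj2 (@ae_eq_measurable_setT R d (fun x => ((v \_ W) x)%:E) _ _ _)).
  apply: negligibleS nDW => x /= ne; apply: contrapT => nDWx; apply: ne => _.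
  rewrite !patchE; have [Wx|Wx] := boolP (x \in W).
    by rewrite mem_set//; apply: WD; exact: set_mem.
  case: ifPn => // Dx; exfalso; apply: nDWx; split; first exact: set_mem.
  by move: Wx; rewrite notin_setE.
exact/measurable_EFinP/(measurable_restrictT _ mW).1.
Qed.

(** The open cells fill [Omega] up to a subset of the skeleton, which completeness makes
    measurable. *)
Lemma measurable_Omega : measurable (Omega : set L).
Proof.
pose U : set L := \bigcup_(K in [set` cells Th]) open_simplex K.
have -> : Omega = U `|` (Omega `\` U).
  apply/seteqP; split => [p Op|p [[K hK Kp]|[]//]].
    by have [Up|Up] := pselect (U p); [left|right].
  exact: (open_simplex_Omega conf hK).
apply: measurableU.
  apply: fin_bigcup_measurable; first exact: finite_finset.
  by move=> K _; exact: measurable_open_simplex.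
apply: (@leb_is_complete R d); apply: negligibleS (negligible_skeleton d0 conf).
move=> p [Op nUp]; apply: contrapT => nsk; apply: nUp.
by have [K hK Kp] := closure_skeleton conf (@subset_closure _ Omega p Op) nsk;
  exists K.
Qed.

(** Meant for [N] containing the points where the bounds on [A] fail. The witness, the open cells
    with vertex [i] minus [N], fills [omega i] up to a null set and allows pointwise estimates. *)
Lemma omega_core i (N : set L) : measurable N -> mu N = 0%E ->
  exists W : set L, [/\ measurable W, mu.-negligible ((omega Omega i : set L)
    `\` W),
    W `<=` omega Omega i, W `<=` Omega & W `<=` ~` N].
Proof.
move=> mN N0.
pose U : set L := \bigcup_(K in [set` [pred K in cells Th | i \in K]])
  open_simplex K.
have mU : measurable U.
  apply: fin_bigcup_measurable; first exact: finite_finset.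
  by move=> K _; exact: measurable_open_simplex.
exists (U `\` N); split.
- exact: measurableD.
- have : mu.-negligible ((skeleton Th : set L) `|` N).
    apply: negligibleU; first exact: (negligible_skeleton d0 conf).
    by exists N; split.
  apply: negligibleS => p [wp nUN].
  have [Np|Np] := pselect (N p); [by right|left].
  apply: contrapT => nsk; apply: nUN; split => //.
  have cp : closure Omega p.
    have [_ _ hout] := hatP conf i.
    apply: (@closed_closure _ Omega); apply: closure_subset wp => q /= hq.
    by apply: contrapT => /hout h; rewrite h eqxx in hq.
  have [K hK Kp] := closure_skeleton conf cp nsk.
  exists K => //; rewrite /= inE hK/=; apply: contrapT => /negP Ki.
  (* If [i] is not a vertex of [K], the hat function vanishes on the open cell, a neighbourhood of
     [p], so [p] is not in the support. *)
  have [q []] := wp _ (open_nbhs_nbhs (conj (@open_open_simplex _ _ _ K) Kp)).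
  move=> /= + Kq; rewrite (hatE conf i hK (sub_open_simplex (kc hK) (ki hK)
    Kq)).
  by rewrite (lam_out (kc hK) (ki hK)) ?eqxx.
- move=> p [[K /andP[hK Ki] Kp] _]; apply: subset_closure => /=.
  by rewrite (hatE conf i hK (sub_open_simplex (kc hK) (ki hK) Kp)) gt_eqF// Kp.
- by move=> p [[K /andP[hK _] Kp] _]; exact: (open_simplex_Omega conf hK).
- by move=> p [].
Qed.

(** In the averaged case the quadratic form, linear in the matrix, passes under the integral and
    inherits the bound valid on the core [W]. *)
Lemma qform_Abar i z : Omega (node i) ->
  qform (Abar Omega A i) z <= Lambda * dotv z z.
Proof.
move=> Oi; rewrite /Abar; case: asboolP => [cA|_].
  exact: qform_le_continuous.
have [mA symA [N [mN N0 subN]]] := hA.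
have [W [mW nW WD WO WN]] := omega_core i mN N0.
have bounds x : W x -> loewner_le lambda%:M (A x) /\ loewner_le (A x) Lambda%:M.
  move=> Wx; apply: contrapT => nb; apply: (WN x Wx); apply: subN => /= h.
  by apply: nb; apply: h; exact: WO.
have muW : (mu W < +oo)%E.
  have [r r0 Or] := bounded_cube bOmega.
  apply: (@le_lt_trans _ _ (mu (cube 0 r))).
    apply: le_measure; rewrite ?inE//.
    - by apply: measurable_cube; exact: ltW.
    - exact: subset_trans WO Or.
  by rewrite [ltLHS](leb_cube 0 (ltW r0)) ltry.
have mAW k l : measurable_fun W (fun x : L => A x k l).
  exact: (measurable_funS measurable_Omega WO (mA k l)).
have intA k l : mu.-integrable W (EFin \o (fun x : L => A x k l)).
  apply: measurable_bounded_integrable => //.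
  exists Lambda; split; first exact: num_real.
  move=> M LM x Wx; apply: le_trans (ltW LM); have [h1 h2] := bounds x Wx.
  by apply: (entry_bound _ _ _ (ltW lambda0)) => //; exact: symA (WO x Wx).
set c := (fine _)^-1.
have intE k l : integral_vec (omega Omega i) (fun x => A x k l) =
    \int[mu]_(x in W) A x k l.
  exact: Rintegral_ae_domain.
have intzA k l : mu.-integrable W (EFin \o (fun x : L =>
  z 0 k * z 0 l * A x k l)).
  have -> : EFin \o (fun x : L => z 0 k * z 0 l * A x k l) =
      (fun x => (z 0 k * z 0 l)%:E * (EFin \o (fun x : L => A x k l)) x)%E.
    by apply/funext => x; rewrite /= EFinM.
  exact: (integrableZl mW _ (intA k l)).
have int_sum (f : 'I_d -> L -> R) : (forall l,
  mu.-integrable W (EFin \o f l)) ->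
    mu.-integrable W (EFin \o (fun x => \sum_l f l x)).
  move=> intf.
  have -> : EFin \o (fun x => \sum_l f l x) = (fun x =>
    \sum_l (EFin \o f l) x)%E.
    by apply/funext => x; rewrite /= sumEFin.
  exact: integrable_sum.
have intq : mu.-integrable W (EFin \o (fun x : L => qform (A x) z)).
  have -> : EFin \o (fun x : L => qform (A x) z) =
      EFin \o (fun x : L => \sum_k \sum_l z 0 k * z 0 l * A x k l).
    by apply/funext => x; rewrite /= qformE.
  by apply: (int_sum) => k; exact: int_sum.
have -> : qform (\matrix_(k, l) (c * integral_vec (omega Omega i) (fun x =>
  A x k l))) z =
    c * \int[mu]_(x in W) qform (A x) z.
  rewrite (@eq_Rintegral _ _ _ mu W
    (fun x : L => \sum_k \sum_l z 0 k * z 0 l * A x k l)); last first.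
    by move=> x _; exact: qformE.
  rewrite Rintegral_sum// => [|k]; last exact: int_sum.
  rewrite qformE mulr_sumr; apply: eq_bigr => k _.
  rewrite Rintegral_sum// mulr_sumr; apply: eq_bigr => l _.
  by rewrite mxE intE RintegralZl//; ring.
have L0 : 0 <= Lambda * dotv z z.
  by rewrite mulr_ge0 ?dotvv_ge0// (le_trans (ltW lambda0)).
have c0 : 0 <= c by rewrite invr_ge0 fine_ge0// outer_measure_ge0.
have intc : mu.-integrable W (EFin \o cst (Lambda * dotv z z)).
  apply: measurable_bounded_integrable => //.
  exists (Lambda * dotv z z); split; first exact: num_real.
  by move=> M LM x Wx; rewrite /= ger0_norm// ltW.
apply: (@le_trans _ _ (c * \int[mu]_(x in W) cst (Lambda * dotv z z) x)).
  rewrite ler_wpM2l//; apply: le_Rintegral => // x Wx.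
  by have [_ /(_ z)] := bounds x Wx; rewrite qform_scalar.
rewrite [X in c * X]Rintegral_cst// mulrCA -[leRHS]mulr1 ler_wpM2l//.
(* A vanishing [fine], infinite volume included, makes [c] zero. Otherwise the volume is finite, and
   monotonicity of the outer measure bounds the volume of [W] by that of [omega i]. *)
have [f0|f0] := eqVneq (fine (mu (omega Omega i))) 0.
  by rewrite /c f0 invr0 mul0r.
have fin : mu (omega Omega i) \is a fin_num by apply: contraNT f0; case: (mu _).
have f1 : 0 < fine (mu (omega Omega i)) by rewrite lt0r f0 fine_ge0//
  outer_measure_ge0.
rewrite /c mulrC ler_pdivrMr// mul1r fine_le//.
  by rewrite ge0_fin_numE.
exact: le_outer_measure.
Qed.

End averaged_coefficient.

Theorem corollary3p2 (R : realType) (d : nat) (Omega : set 'rV[R]_d)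
    (Th : mesh R d) (A : 'rV[R]_d -> 'M[R]_d) (lambda Lambda eps : R)
    (phi : 'rV[R]_d -> R) (w : 'rV[R]_d -> R) :
  (2 <= d)%N ->
  bounded_domain Omega ->
  conforming_mesh Omega Th ->
  0 < lambda -> lambda <= Lambda ->
  coefficient_ok Omega A lambda Lambda ->
  0 < eps ->
  kernel_ok phi ->
  weakly_acute Omega Th ->
  Vh Omega Th w ->
  (forall i : 'I_(nb_nodes Th), interior_node Omega i ->
     0 <= L_eps_h Omega A lambda Lambda eps phi w i) ->
  (forall x, boundary Omega x -> w x <= 0) ->
  forall x, Omega x -> w x <= 0.
Proof.
move=> d2 [oO cO _ bO] conf lambda0 lamLam hA eps0 hphi acute wV Lw wb x Ox.
have d0 : (0 < d)%N by apply: leq_trans d2.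
have cx := @subset_closure _ Omega x Ox.
(* A cell containing [x] supplies the node that [arg_maxP] requires. *)
have [K0 hK0 _] := closure_simplex conf cx.
have /card_gt0P[a0 _] : (0 < #|K0|)%N by rewrite (mesh_cell_card conf hK0).
have [i _ wi] := @arg_maxP _ _ _ a0 xpredT (fun j => w (node j)) isT.
pose m := w (node i).
have wm (j : 'I_(nb_nodes Th)) : w (node j) <= m by exact: wi.
have wmax p : closure Omega p -> w p <= m.
  move=> /(closure_simplex conf)[K hK Kp].
  have kc := mesh_cell_card conf hK; have ki := mesh_cell_indep conf hK.
  rewrite (Vh_lam conf wV hK Kp) -[leRHS]mul1r -(lam_sum kc ki p) mulr_suml.
  rewrite [leRHS]big_mkcond/=; apply: ler_sum => j _.
  have l0 := (simplexP kc ki p).1 Kp j.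
  case: ifPn => [_|Kj]; first by rewrite ler_wpM2l.
  by rewrite (lam_out kc ki p Kj) mul0r.
rewrite leNgt; apply/negP => wx; have m0 : 0 < m
  by exact: lt_le_trans (wmax _ cx).
have inner (j : 'I_(nb_nodes Th)) : w (node j) = m -> Omega (node j).
  move=> wj; apply: contrapT => nO.
  have /wb : boundary Omega (node j).
    by split; [exact: node_closure|move=> /interior_subset].
  by rewrite wj leNgt m0.
have subsol (j : 'I_(nb_nodes Th)) : w (node j) = m ->
    integral_vec Omega (fun x => dotv (grad w x) (grad (hat Omega j) x)) <= 0.
  move=> wj; have Oj := inner j wj.
  have I0 : I_eps Omega A lambda Lambda eps phi w j <= 0.
    apply: I_eps_le0 => // [xi|p cp]; last by rewrite wj; exact: wmax.
    exact: (qform_Abar d0 bO oO conf lambda0 lamLam hA xi Oj).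
  have := Lw j Oj; rewrite /L_eps_h => Lj.
  have : 0 <= lambda / 2 * laplace_h Omega w j.
    by apply: le_trans Lj _; rewrite gerDl.
  (* The minus sign in [laplace_h] reverses the inequality once the positive mass of the hat
     function is cleared. *)
  rewrite pmulr_rge0 ?divr_gt0// /laplace_h mulNr oppr_ge0.
  by rewrite pmulr_rle0// invr_gt0 (integral_hat_gt0 d0 bO conf).
have [p bp wp] := maximum_boundary d0 conf oO cO wV wm
  (fun K a b hK Ka Kb wa => maximum_propagates d0 bO conf acute wV wm subsol hK
    Ka Kb wa)
  (inner i erefl) erefl.
by have := wb p bp; rewrite wp leNgt m0.
Qed.
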